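(* Let $K\subseteq\mathbb{R}^n$ be a convex body with $0\in K$. Then for any $p>0$ $$\mathrm{conv}(K_p(\tilde{g}_K))\subseteq\left(\frac{G_n(K+C_n)}{G_n(K)}\right)^{\frac1p}K_p(\tilde{g}_{K+C_n}).$$
   Context: A convex body is a compact convex set with non-empty interior; $\mathrm{conv}$ denotes convex hull. $G_n(A)=|A\cap\mathbb{Z}^n|$ for $A\subseteq\mathbb{R}^n$, and $C_n=(-1,1)^n$; $+$ between sets is the Minkowski sum. For a set $L\subseteq\mathbb{R}^n$ (here $L=K$ or $L=K+C_n$) the discrete covariogram is $\tilde{g}_L(x)=G_n(L\cap(x+L))$, $x\in\mathbb{R}^n$. For a measurable $g:\mathbb{R}^n\to[0,\infty)$ with $g(0)>0$ and $p>0$, the $p$-th Ball body of $g$ is $K_p(g)=\{x\in\mathbb{R}^n: p\int_0^\infty r^{p-1}g(rx)\,dr\geq g(0)\}$. *)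

(* Defs.v *)
From HB Require Import structures.
From mathcomp Require Import all_boot all_order all_algebra finmap zify.
From mathcomp Require Import all_classical all_reals all_analysis.

Set Implicit Arguments.
Unset Strict Implicit.
Unset Printing Implicit Defensive.

Import Order.TTheory GRing.Theory Num.Theory.
Import numFieldNormedType.Exports.

Local Open Scope classical_set_scope.
Local Open Scope ring_scope.

Section Definitions.
Variables (R : realType) (n : nat).
Implicit Types (A B K L : set 'rV[R]_n) (g : 'rV[R]_n -> R) (p : R).

Definition convex_body K : Prop :=
  [/\ compact K, convex_set K & K° !=set0].

Definition convex_hull A : set 'rV[R]_n := smallest (@convex_set R 'rV[R]_n) A.

Definition minkowski_sum A B : set 'rV[R]_n := [set a + b | a in A & b in B].

Definition translate (x : 'rV[R]_n) A : set 'rV[R]_n := [set x + a | a in A].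

Definition dilate (c : R) A : set 'rV[R]_n := [set c *: a | a in A].

Definition integer_lattice : set 'rV[R]_n :=
  [set x | forall i, x 0 i \is a Num.int].

Definition open_cube : set 'rV[R]_n := [set x | forall i, -1 < x 0 i < 1].

(* Since [fset_set] is empty on infinite sets, this is |A ∩ Z^n| only when that
   set is finite; see [finite_lattice_points] for bounded A. *)
Definition lattice_count A : nat := #|` fset_set (A `&` integer_lattice)|.

Definition discrete_covariogram L (x : 'rV[R]_n) : R :=
  (lattice_count (L `&` translate x L))%:R.

(* The integral is taken in the extended reals because it may be +oo, as it is
   at x = 0. *)
Definition ball_body p g : set 'rV[R]_n :=
  [set x | ((g 0)%:E <= p%:E *
    \int[lebesgue_measure]_(r in `]0%R, +oo[) (r `^ (p - 1) * g (r *: x))%:E)%E].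

Lemma finite_lattice_points A :
  bounded_set A -> finite_set (A `&` integer_lattice).
Proof.
move=> [M0 [_ /(_ (M0 + 1))]]; rewrite ltrDl ltr01 => /(_ isT).
set M := M0 + 1 => AM; pose m := Num.bound M.
pose f (h : {ffun 'I_n -> 'I_(m.*2.+1)}) : 'rV[R]_n :=
  \row_i ((h i : nat)%:R - m%:R).
apply: (@sub_finite_set _ _ (f @` setT)); last first.
  exact/finite_image/finite_finset.
move=> x [/AM /= xM xZ].
have xm i : `|x 0 i| <= m%:R.
  apply/ltW/(@le_lt_trans _ _ M); last first.
    by apply: archi_boundP; exact: le_trans xM.
  apply: le_trans xM; rewrite [in leRHS]/Num.norm /= mx_normrE.
  exact: (le_bigmax _ (fun ij => `|x ij.1 ij.2|) (0, i)).
have xk i : exists k : 'I_(m.*2.+1), x 0 i = (k : nat)%:R - m%:R.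
  have /intrP[z xz] := xZ i.
  have /andP[mz zm] : - m%:Z <= z <= m%:Z.
    by rewrite -ler_norml -(ler_int R) intr_norm -xz.
  have km : (absz (z + m%:Z)%R < m.*2.+1)%N by lia.
  exists (Ordinal km) => /=.
  have /(congr1 (fun y : int => y%:~R : R)) : (absz (z + m%:Z))%:Z = z + m%:Z by lia.
  by rewrite intrD -xz pmulrn => ->; rewrite addrK.
have [h hx] := choice xk.
exists [ffun i => h i] => //; apply/rowP => i.
by rewrite mxE ffunE hx.
Qed.

End Definitions.

Arguments integer_lattice {R n}.
Arguments open_cube {R n}.

(* Main.v *)
Require Import Defs.
From HB Require Import structures.
From mathcomp Require Import all_boot all_order all_algebra finmap.
From mathcomp Require Import all_classical all_reals all_analysis.
From mathcomp Require Import measurable_realfun zify lra ring.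

Import Order.TTheory GRing.Theory Num.Theory.
Import numFieldNormedType.Exports.

Set Implicit Arguments.
Unset Strict Implicit.
Unset Printing Implicit Defensive.

Local Open Scope classical_set_scope.
Local Open Scope ring_scope.

(** Write [f] for the covariogram of [K], [h] for that of [K + C] with [C] the
    open cube, and [I g x] for the integral of [r ^ (p - 1) * g (r x)] over
    [r > 0]. The point is to insert between [f] and [h] a function [F] to which
    Ball's theorem on log-concave functions applies.

    Let [x] be a convex combination of the [y_i] with weights [w_i]. By convexity
    of [K], the same combination of points common to [K] and [y_i + K] is common
    to [K] and [x + K], and adding a point of [C] keeps it in [K + C] and in
    [x + K + C]. The discrete
    Brunn-Minkowski inequality, [discrete_brunn_minkowski], therefore bounds
    the product of the [f (y_i) ^ w_i] by [h x]. It must be known for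
    combinations of arbitrary length: every application costs one summand [C],
    so the case of two points cannot be iterated. The supremum [F x] of these
    products over all ways of writing [x] is a log-concave function with
    [f <= F <= h].

    The discrete inequality is proved as the Prekopa-Leindler inequality on
    integer points. On the line it reduces to superlevel sets, all of which are
    nonempty once the functions are scaled to have maximum 1, and these are
    handled by [brunn_minkowski_1d]; it then tensorizes over the coordinates.

    Ball's theorem, here [moment_quasi_concave], says that [{x | M <= I F x}] is
    convex. With [phi_x r = r ^ (p + 1) * F (r x)] one has
    [I F x = int phi_x r dr / r ^ 2], and by log-concavity
    [phi_z t >= phi_x r ^ m * phi_y s ^ l] for some weights [m + l = 1] whenever
    [1 / t = u / r + v / s] and [z = u x + v y]. So superlevel sets combine
    along weighted harmonic means, under which the measure [dr / r ^ 2] of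
    intervals is additive. Integrating over the levels gives the result when
    [phi_x] and [phi_y] have the same supremum. Scaling [x] and [y] achieves
    this, and the factors so introduced disappear by convexity of the power
    [p + 1].

    Hence [{x | f 0 <= p * I F x}] is a convex set containing the Ball body of
    [f], so it contains the convex hull. As [F <= h] and [I h] is homogeneous of
    degree [-p], dividing its points by [(h 0 / f 0) ^ (1 / p)] puts them into
    the Ball body of [h]. *)

(** * The weighted inequality of arithmetic and geometric means *)

Lemma powR_prod (R : realType) (I : finType) (a : I -> R) (r : R) :
  (forall i, 0 <= a i) -> (\prod_i a i) `^ r = \prod_i a i `^ r.
Proof.
move=> a0.
suff : forall s : seq I,
  (\prod_(i <- s) a i) `^ r = \prod_(i <- s) a i `^ r by exact.
elim=> [|i s IH]; first by rewrite !big_nil powR1.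
by rewrite !big_cons powRM ?IH// prodr_ge0.
Qed.

Lemma prod_powR_sum (R : realType) (I : finType) (w : I -> R) (a : R) :
  0 < a -> \prod_i a `^ w i = a `^ (\sum_i w i).
Proof.
move=> a0.
suff : forall s : seq I,
  \prod_(i <- s) a `^ w i = a `^ (\sum_(i <- s) w i) by exact.
elim=> [|i s IH]; first by rewrite !big_nil powRr0.
by rewrite !big_cons IH powRD// (gt_eqF a0) implybT.
Qed.

Lemma prod_powR_eq0 (R : realType) (I : finType) (w a : I -> R) i :
  0 < w i -> a i = 0 -> \prod_i a i `^ w i = 0.
Proof.
by move=> wi ai; rewrite (bigD1 i)//= ai powR0 ?mul0r// gt_eqF.
Qed.

(** After dividing all [a i] by the arithmetic mean [S] this is
    [t <= exp (t - 1)], multiplied out: the exponents [w i * (a i / S - 1)] add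
    up to 0. *)
Lemma weighted_AGM (R : realType) (I : finType) (w a : I -> R) :
  (forall i, 0 <= w i) -> \sum_i w i = 1 -> (forall i, 0 <= a i) ->
  \prod_i a i `^ w i <= \sum_i w i * a i.
Proof.
move=> w0 w1 a0; set S := \sum_i w i * a i.
have S0 : 0 <= S by apply: sumr_ge0 => i _; exact: mulr_ge0.
have [S_eq0|Sneq0] := eqVneq S 0.
  have [i wi] : exists i, 0 < w i.
    apply: contrapT => /forallNP w_le0; move: (oner_neq0 R).
    rewrite -w1 big1 ?eqxx// => i _.
    by apply/eqP; rewrite eq_le w0 andbT leNgt; apply/negP/w_le0.
  rewrite S_eq0 (@prod_powR_eq0 _ _ _ _ i)//.
  have /eqP : S == 0 by exact/eqP.
  move=> /psumr_eq0P -/(_ (fun i _ => mulr_ge0 (w0 i) (a0 i)) i isT)/eqP.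
  by rewrite mulf_eq0 gt_eqF//= => /eqP.
have Sgt0 : 0 < S by rewrite lt_neqAle eq_sym Sneq0.
have -> : \prod_i a i `^ w i = S * \prod_i (a i / S) `^ w i.
  have SE : \prod_i S `^ w i = S by rewrite prod_powR_sum// w1 powRr1.
  rewrite -[X in _ = X * _]SE.
  rewrite -big_split/=.
  apply: eq_bigr => i _; rewrite -powRM// ?divr_ge0//.
  by rewrite mulrC divfK.
rewrite ger_pMr//.
apply: (@le_trans _ _ (\prod_i expR (w i * (a i / S - 1)))).
  apply: ler_prod => i _; rewrite powR_ge0/= [w i * _]mulrC expRM.
  apply: ge0_ler_powR => //; rewrite ?nnegrE ?divr_ge0 ?expR_ge0//.
  by have := expR_ge1Dx (a i / S - 1); rewrite addrC subrK.
rewrite -expR_sum -[leRHS]expR0 ler_expR.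
rewrite (eq_bigr (fun i => w i * a i / S - w i)) => [|i _]; last by ring.
by rewrite sumrB -mulr_suml w1 divff// subrr.
Qed.

Lemma natr_card_set (R : pzSemiRingType) (T : finType) (P : pred T) :
  #|[set x | P x]%SET|%:R = \sum_x (P x)%:R :> R.
Proof.
rewrite -sum1_card natr_sum big_mkcond/=.
by apply: eq_bigr => x _; rewrite inE; case: (P x).
Qed.

(** * The discrete Brunn-Minkowski inequality on the line *)

(** A chain of reals whose steps are at least [d j <= 1] passes near many
    integers. The induction needs the surplus [c - t J], where [c] is the
    ceiling of [t J]: a step that stays below [c] meets no new integer but uses
    up surplus, a step that passes [c] meets one, and a step that jumps past
    [c + 1] meets two unless it lands on an integer. *)
Lemma card_near_chain (R : realType) (M : nat) (t d : nat -> R) :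
  (forall j, 0 <= t j <= M%:R) -> (forall j, 0 <= d j <= 1) ->
  (forall j, t j + d j <= t j.+1) ->
  forall J, 1 + \sum_(j < J) d j <=
    #|[set z : 'I_M.+1 | `[< exists2 j,
         (j <= J)%N & `|(z : nat)%:R - t j| < 1 >]]%SET|%:R.
Proof.
move=> tM d01 tS J.
pose S J := [set z : 'I_M.+1 | `[< exists2 j,
  (j <= J)%N & `|(z : nat)%:R - t j| < 1 >]]%SET.
have tle i j : (i <= j)%N -> t i <= t j.
  elim: j => [|j IH]; first by rewrite leqn0 => /eqP->.
  rewrite leq_eqVlt => /predU1P[->//|/IH /le_trans]; apply.
  by apply: le_trans (tS j); rewrite lerDl; case/andP: (d01 j).
have ceilP j : exists c : 'I_M.+1, (c : nat)%:R - 1 < t j <= (c : nat)%:R.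
  have exc : exists c, t j <= c%:R by exists M; case/andP: (tM j).
  case: (ex_minnP exc) => c tc cmin.
  have cM : (c < M.+1)%N by rewrite ltnS; apply: cmin; case/andP: (tM j).
  exists (Ordinal cM) => /=; rewrite tc andbT.
  case: c tc cmin {cM} => [|c] tc cmin.
    by rewrite sub0r (@lt_le_trans _ _ 0)// ?oppr_lt0//; case/andP: (tM j).
  rewrite -natr1 addrK ltNge; apply/negP => /cmin; by rewrite ltnn.
have inS j (z : 'I_M.+1) : `|(z : nat)%:R - t j| < 1 ->
    forall k, (j <= k)%N -> z \in S k.
  by move=> zj k jk; rewrite inE; apply/asboolP; exists j.
have SleC j (c z : 'I_M.+1) : t j <= (c : nat)%:R -> z \in S j -> (z <= c)%N.
  move=> tc; rewrite inE => /asboolP[k kj]; rewrite ltr_norml => /andP[_ zt].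
  have := tle _ _ kj => tkj.
  rewrite -ltnS -(ltr_nat R) -natr1.
  by lra.
suff H : forall c : 'I_M.+1, (c : nat)%:R - 1 < t J <= (c : nat)%:R ->
   1 + \sum_(j < J) d j + ((c : nat)%:R - t J) <= #|S J|%:R.
  have [c cP] := ceilP J; apply: le_trans (H _ cP); case/andP: cP => _.
  by rewrite -subr_ge0 lerDl.
elim: J => [|J IH] c' /andP[c't' t'c'].
  rewrite big_ord0 addr0.
  have c'S : c' \in S 0%N by apply: (inS 0%N) => //; rewrite ltr_norml; lra.
  have [tE|tN] := eqVneq (t 0%N) (c' : nat)%:R.
    rewrite tE subrr addr0 ler1n; apply/fintype.card_gt0P; by exists c'.
  have tlt : t 0%N < (c' : nat)%:R by rewrite lt_neqAle tN.
  case: c' c't' t'c' c'S tN tlt => -[|c] cM /=.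
    by case/andP: (tM 0%N) => *; exfalso; lra.
  rewrite -natr1 addrK => *.
  have cM' : (c < M.+1)%N by apply: ltnW.
  have : [set Ordinal cM; Ordinal cM']%SET \subset S 0%N.
    apply/fintype.subsetP => x; rewrite !inE => /orP[]/eqP->; exists 0%N => //=;
      rewrite ltr_norml -?natr1; lra.
  move=> /subset_leq_card; rewrite cards2; have -> : Ordinal cM != Ordinal cM'.
    by apply/eqP => /(congr1 val) /= ; lia.
  rewrite -(ler_nat R) /= => ?; lra.
have [c cP] := ceilP J; have {IH} := IH c cP.
case/andP: cP => ct tc.
rewrite big_ord_recr /=; set s := \sum_(j < J) d j => IH.
have subS : S J \subset S J.+1.
  apply/fintype.subsetP => x; rewrite !inE => -[j jJ xj]; exists j => //.
  exact: leqW.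
have tSJ := tS J; have /andP[dJ0 dJ1] := d01 J.
have cc' : (c <= c')%N.
  rewrite -ltnS -(ltr_nat R) -natr1; lra.
have [cE|cN] := eqVneq c c'.
  have := subset_leq_card subS; rewrite -(ler_nat R) => ?.
  rewrite -cE; lra.
have {cN}cc' : (c < c')%N by rewrite ltn_neqAle cc' andbT.
have c'S : c' \in S J.+1 by apply: (inS J.+1) => //; rewrite ltr_norml; lra.
have c'NS : c' \notin S J by apply/negP => /(SleC _ _ _ tc); rewrite leqNgt cc'.
have sub1 : (c' |: S J)%SET \subset S J.+1.
  by rewrite finset.subUset finset.sub1set c'S.
have [c'E|c'N] := eqVneq (c' : nat) c.+1.
  have := subset_leq_card sub1; rewrite cardsU1 c'NS -(ler_nat R) natrD /= => ?.
  rewrite c'E -natr1; lra.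
have [tE|tN] := eqVneq (t J.+1) (c' : nat)%:R.
  have := subset_leq_card sub1; rewrite cardsU1 c'NS -(ler_nat R) natrD /= => ?.
  rewrite tE; lra.
have tlt : t J.+1 < (c' : nat)%:R by rewrite lt_neqAle tN.
have c''M : (c'.-1 < M.+1)%N by exact: leq_ltn_trans (leq_pred _) (ltn_ord c').
pose c'' := Ordinal c''M.
have c''E : (c'' : nat)%:R = (c' : nat)%:R - 1 :> R.
  by rewrite -[(c' : nat)](ltn_predK cc') -natr1 addrK.
have c''S : c'' \in S J.+1.
  by apply: (inS J.+1) => //; rewrite ltr_norml c''E; lra.
have c''NS : c'' \notin (c' |: S J)%SET.
  rewrite in_setU1 negb_or; apply/andP; split.
    apply/eqP => /(congr1 val) /= E; move: cc' c'N; rewrite -E /=.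
    by case: (c' : nat) E => [|k] //= /n_Sn.
  apply/negP => /(SleC _ _ _ tc) /= c'c; move/eqP: c'N; apply; apply/eqP.
  by rewrite eqn_leq cc' andbT -(ltn_predK cc') ltnS.
have := subset_leq_card (_ : (c'' |: (c' |: S J))%SET \subset S J.+1).
rewrite !cardsU1 c''NS c'NS finset.subUset sub1 finset.sub1set c''S => /(_ isT).
rewrite -(ler_nat R) !natrD /= => ?; lra.
Qed.

Lemma sorted_enum_set (M : nat) (A : {set 'I_M}) :
  sorted (fun i j : 'I_M => (i < j)%N) (enum A).
Proof.
rewrite /enum_mem -enumT.
apply: sorted_filter => [y x z|]; first exact: ltn_trans.
by rewrite -[sorted _ _](@sorted_map _ _ val ltn) val_enum_ord iota_ltn_sorted.
Qed.

Lemma sum_ltn_succ (N m : nat) : (\sum_(j < m) (j.+1 < N) = minn m N.-1)%N.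
Proof.
elim: m => [|m IH]; first by rewrite big_ord0 min0n.
by rewrite big_ord_recr/= IH; case: ltnP; lia.
Qed.

(** Run through all the sets [A i] simultaneously and in increasing order, each
    stopping at its maximum. At time [j] the combination of the current points
    moves by at least the total weight [d j <= 1] of the sets still running,
    and set [i] runs for [#|A i| - 1] steps. *)
Lemma brunn_minkowski_1d (R : realType) (M : nat) (I : finType) (w : I -> R)
    (A : I -> {set 'I_M.+1}) :
  (forall i, 0 <= w i) -> \sum_i w i = 1 -> (forall i, (0 < #|A i|)%N) ->
  \sum_i w i * #|A i|%:R <=
  #|[set z : 'I_M.+1 | `[< exists2 k : I -> 'I_M.+1, forall i, k i \in A i &
     `|(z : nat)%:R - \sum_i w i * (k i : nat)%:R| < 1 >] ]%SET|%:R.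
Proof.
move=> w0 w1 A0.
pose a i j := nth ord0 (enum (A i)) (minn j #|A i|.-1).
pose t j := \sum_i w i * (a i j : nat)%:R.
pose d j := \sum_i w i * (j.+1 < #|A i|)%N%:R.
have aA i j : a i j \in A i.
  by rewrite -mem_enum mem_nth// -cardE gtn_min ltn_predL A0 orbT.
have := @card_near_chain R M t d _ _ _ M.+1.
have -> : 1 + \sum_(j < M.+1) d j = \sum_i w i * #|A i|%:R.
  rewrite exchange_big/= -[X in X + _]w1 -big_split/=; apply: eq_bigr => i _.
  rewrite -mulr_sumr -natr_sum sum_ltn_succ -[X in X + _]mulr1 -mulrDr; congr (_ * _).
  rewrite nat1r; congr (_%:R).
  have AM : (#|A i| <= M.+1)%N by rewrite -[leqRHS]card_ord max_card.
  by have := A0 i; move: AM; set N := #|A i|; lia.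
move=> H; apply: le_trans (H _ _ _) _ => {H} [j|j|j|].
- rewrite sumr_ge0/= => [|i _]; last by rewrite mulr_ge0.
  rewrite -[leRHS]mul1r -[X in X * _]w1 mulr_suml; apply: ler_sum => i _.
  by rewrite ler_wpM2l// ler_nat -ltnS.
- rewrite sumr_ge0/= => [|i _]; last by rewrite mulr_ge0.
  by rewrite -[leRHS]w1; apply: ler_sum => i _; rewrite ler_piMr// lern1 leq_b1.
- rewrite -big_split; apply: ler_sum => i _ /=.
  rewrite -mulrDr ler_wpM2l// -natrD ler_nat /a.
  have [jN|jN] := ltnP j.+1 #|A i|; last first.
    have jN' : (#|A i|.-1 <= j)%N by rewrite -ltnS (ltn_predK (A0 i)).
    by rewrite addn0 (minn_idPr jN') (minn_idPr (leqW jN')).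
  have jN' : (j < #|A i|.-1)%N by rewrite -ltnS (ltn_predK jN).
  rewrite addn1 (minn_idPl (ltnW jN')) (minn_idPl jN').
  apply: (sorted_ltn_nth (leT := fun i j : 'I_M.+1 => (i < j)%N)) => //.
  - by move=> y x z; exact: ltn_trans.
  - exact: sorted_enum_set.
  - by rewrite inE -cardE ltnW.
  - by rewrite inE -cardE.
- rewrite ler_nat; apply: subset_leq_card; apply/fintype.subsetP => z.
  rewrite !inE => -[j _ zj]; exists (a^~ j) => //.
Qed.

(** * The Prekopa-Leindler inequality on integer points *)

Lemma indic_itvNyo (R : realType) (c : R) :
  \1_(`]-oo, c[%classic : set R) = (fun b : R => (b < c)%R%:R) :> (R -> R).
Proof.
by apply/funext => b; rewrite indicE mem_setE/= in_itv.
Qed.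

Lemma indic_itvNyc (R : realType) (c : R) :
  \1_(`]-oo, c]%classic : set R) = (fun b : R => (b <= c)%R%:R) :> (R -> R).
Proof.
by apply/funext => b; rewrite indicE mem_setE/= in_itv.
Qed.

Lemma integral_itv01_lt (R : realType) (c : R) : 0 <= c <= 1 ->
  (\int[lebesgue_measure]_(b in `]0%R, 1%R[) ((b < c)%R%:R%:E) = c%:E)%E.
Proof.
move=> /andP[c0 c1].
transitivity (\int[lebesgue_measure]_(b in `]0%R, 1%R[)
    ((\1_(`]-oo, c[%classic : set R) b)%:E))%E.
  by apply: eq_integral => b _; rewrite ?indic_itvNyo ?indic_itvNyc.
rewrite integral_indic//= (_ : _ `&` _ = `]0, c[%classic); last first.
  by apply/seteqP; split => b /=; rewrite !in_itv/=; lra.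
by rewrite lebesgue_measure_itv/= lte_fin; case: ltgtP c0 => // [|<-]//; rewrite sube0.
Qed.

Lemma integral_itv01_le (R : realType) (c : R) : 0 <= c ->
  (\int[lebesgue_measure]_(b in `]0%R, 1%R[) ((b <= c)%R%:R%:E) <= c%:E)%E.
Proof.
move=> c0.
have -> : (\int[lebesgue_measure]_(b in `]0%R, 1%R[) ((b <= c)%R%:R%:E) =
    \int[lebesgue_measure]_(b in `]0%R, 1%R[)
      ((\1_(`]-oo, c]%classic : set R) b)%:E))%E.
  by apply: eq_integral => b _; rewrite ?indic_itvNyo ?indic_itvNyc.
rewrite integral_indic//=.
apply: (@le_trans _ _ (lebesgue_measure (`]0, c]%classic : set R))).
  apply: le_measure; rewrite ?inE//; first exact: measurableI.
  by move=> b /=; rewrite !in_itv/= => -[-> /andP[->]].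
rewrite lebesgue_measure_itv/= lte_fin; case: ltgtP c0 => // [|<-]//.
by rewrite sube0.
Qed.

(** Layer cake: integrating the cardinals of the superlevel sets over the levels
    [b] in [(0, 1)] gives the sum of each [f i], and the sum of [min (H z) 1],
    which is at most the sum of [H]. *)
Lemma sum_le_of_superlevels (R : realType) (I T : finType) (w : I -> R)
    (f : I -> T -> R) (H : T -> R) :
  (forall i, 0 <= w i) -> (forall i k, 0 <= f i k <= 1) -> (forall z, 0 <= H z) ->
  (forall b, 0 < b < 1 ->
    \sum_i w i * #|[set k | b < f i k]%SET|%:R <= #|[set z | b <= H z]%SET|%:R) ->
  \sum_i w i * \sum_k f i k <= \sum_z H z.
Proof.
move=> w0 f01 H0 lev; rewrite -lee_fin.
have mlt c : measurable_fun (`]0%R, 1%R[%classic : set R)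
    (EFin \o (fun b : R => (b < c)%R%:R : R)).
  apply/measurable_EFinP; apply: (measurable_funS measurableT) => //.
  by rewrite -(indic_itvNyo c).
have mle c : measurable_fun (`]0%R, 1%R[%classic : set R)
    (EFin \o (fun b : R => (b <= c)%R%:R : R)).
  apply/measurable_EFinP; apply: (measurable_funS measurableT) => //.
  by rewrite -(indic_itvNyc c).
apply: (@le_trans _ _
  (\int[lebesgue_measure]_(b in `]0%R, 1%R[) \sum_(z : T) ((b <= H z)%R%:R%:E))%E); last first.
  rewrite ge0_integral_sum//; last by move=> z; exact: mle.
  by rewrite -sumEFin; apply: lee_sum => z _; exact: integral_itv01_le.
have -> : ((\sum_i w i * \sum_k f i k)%:E =
  \int[lebesgue_measure]_(b in `]0%R, 1%R[)
    \sum_(i : I) ((w i)%:E * \sum_(k : T) (b < f i k)%R%:R%:E))%E.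
  rewrite ge0_integral_sum//; last 2 first.
  - by move=> i; apply: measurable_funeM; apply: emeasurable_sum => k; exact: mlt.
  - by move=> i b _; rewrite mule_ge0 ?lee_fin// sume_ge0// => k _; rewrite lee_fin.
  rewrite -sumEFin; apply: eq_bigr => i _.
  rewrite ge0_integralZl//; last 3 first.
  - by apply: emeasurable_sum => k; exact: mlt.
  - by move=> b _; rewrite sume_ge0// => k _; rewrite lee_fin.
  - by rewrite lee_fin.
  rewrite EFinM; congr (_ * _)%E.
  rewrite ge0_integral_sum//; last by move=> k; exact: mlt.
  by rewrite -sumEFin; apply: eq_bigr => k _; rewrite integral_itv01_lt.
apply: ge0_le_integral => //.
- move=> b _; apply: sume_ge0 => i _; rewrite mule_ge0 ?lee_fin//.
  by rewrite sume_ge0// => k _; rewrite lee_fin.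
- apply: emeasurable_sum => i; apply: measurable_funeM.
  by apply: emeasurable_sum => k; exact: mlt.
- by apply: emeasurable_sum => k; exact: mle.
move=> b /=; rewrite in_itv/= => /lev.
rewrite (eq_bigr (fun i => w i * \sum_k (b < f i k)%R%:R)); last first.
  by move=> i _; rewrite (natr_card_set _ (fun k => b < f i k)).
rewrite (natr_card_set _ (fun z => b <= H z)) -lee_fin -!sumEFin; apply: le_trans.
by apply: lee_sum => i _; rewrite EFinM -sumEFin.
Qed.

(** Dividing each [f i] by its maximum makes all superlevel sets of levels below
    1 nonempty, so that they can be compared by [brunn_minkowski_1d]. This gives
    the arithmetic mean of the sums of the scaled functions as a lower bound,
    which dominates their geometric mean; the latter is homogeneous, so the
    scaling can be undone. *)
Lemma prekopa_leindler_1d (R : realType) (M : nat) (I : finType) (w : I -> R)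
    (f : I -> 'I_M.+1 -> R) (H : 'I_M.+1 -> R) :
  (forall i, 0 < w i) -> \sum_i w i = 1 ->
  (forall i k, 0 <= f i k) -> (forall z, 0 <= H z) ->
  (forall (z : 'I_M.+1) (k : I -> 'I_M.+1),
    `|(z : nat)%:R - \sum_i w i * (k i : nat)%:R| < 1 ->
    \prod_i f i (k i) `^ w i <= H z) ->
  \prod_i (\sum_k f i k) `^ w i <= \sum_z H z.
Proof.
move=> w0 w1 f0 H0 fH.
have [[i fi0]|fN0] := pselect (exists i, forall k, f i k = 0).
  rewrite (@prod_powR_eq0 _ _ _ _ i)//; first by rewrite sumr_ge0.
  by rewrite big1.
have /choice[m mP] i : exists m : 'I_M.+1, 0 < f i m /\ forall k, f i k <= f i m.
  exists [arg max_(m > ord0) f i m]%O; case: arg_maxP => //= m _ mmax.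
  split; last by move=> k; exact: mmax.
  rewrite lt_neqAle f0 andbT eq_sym; apply/eqP => fm0; apply: fN0; exists i => k.
  by apply/eqP; rewrite eq_le f0 -fm0 mmax.
have m0 i := (mP i).1; have mmax i := (mP i).2.
pose C := \prod_i f i (m i) `^ w i.
have C0 : 0 < C by apply: prodr_gt0 => i _; rewrite powR_gt0.
pose g i k := f i k / f i (m i).
have g01 i k : 0 <= g i k <= 1.
  by rewrite divr_ge0//= ?ler_pdivrMr// ?mul1r// ltW.
have gE i k : f i k = f i (m i) * g i k by rewrite mulrC divfK ?gt_eqF.
have prodE (x : I -> R) : (forall i, 0 <= x i) ->
    \prod_i (f i (m i) * x i) `^ w i = C * \prod_i x i `^ w i.
  by move=> x0; rewrite -big_split; apply: eq_bigr => i _; rewrite powRM// ltW.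
rewrite (eq_bigr (fun i => (f i (m i) * \sum_k g i k) `^ w i)); last first.
  by move=> i _; rewrite mulr_sumr; congr (_ `^ _); apply: eq_bigr => k _; rewrite -gE.
have sg0 i : 0 <= \sum_k g i k by apply: sumr_ge0 => k _; case/andP: (g01 i k).
rewrite prodE// -ler_pdivlMl// mulr_sumr.
have w0' i := ltW (w0 i).
apply: le_trans (weighted_AGM w0' w1 sg0) _.
apply: sum_le_of_superlevels => // [z|b /andP[b0 b1]].
  by rewrite mulr_ge0// invr_ge0 ltW.
apply: le_trans (brunn_minkowski_1d w0' w1 _) _.
  move=> i; apply/fintype.card_gt0P; exists (m i).
  by rewrite inE /g divff// gt_eqF.
rewrite ler_nat; apply: subset_leq_card; apply/fintype.subsetP => z.
rewrite !inE => -[k kb /fH] fk.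
rewrite ler_pdivlMl//; apply: le_trans fk.
rewrite (eq_bigr (fun i => (f i (m i) * g i (k i)) `^ w i)); last first.
  by move=> i _; rewrite -gE.
rewrite prodE; last by move=> i; case/andP: (g01 i (k i)).
rewrite ler_pM2l// -[leLHS](powRr1 (ltW b0)) -[X in _ `^ X]w1 -prod_powR_sum//.
apply: ler_prod => i _; rewrite powR_ge0/=.
have bg : b < g i (k i) by have := kb i; rewrite inE.
by apply: ge0_ler_powR => //; rewrite ?nnegrE ltW// (lt_trans b0).
Qed.

Lemma big_tuple_cons (R : nmodType) (T : finType) (n : nat) (F : n.+1.-tuple T -> R) :
  \sum_t F t = \sum_(x : T) \sum_(t : n.-tuple T) F [tuple of x :: t].
Proof.
rewrite pair_big/= (reindex (fun p : T * n.-tuple T => [tuple of p.1 :: p.2]))//=.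
exists (fun t : n.+1.-tuple T => (thead t, [tuple of behead t])) => [[x t] _|t _] /=.
  by congr (_, _); apply/val_inj.
by rewrite -tuple_eta.
Qed.

(** Tensorization: the sums over all but the first coordinate satisfy the
    hypothesis of the inequality on the line, by induction. The box
    [{0, ..., M} ^ n] may stand for the whole lattice because integers at
    distance less than 1 from a point of [[0, M]] are again in [[0, M]]. *)
Lemma prekopa_leindler_tuple (R : realType) (M n : nat) (I : finType) (w : I -> R)
    (f : I -> n.-tuple 'I_M.+1 -> R) (H : n.-tuple 'I_M.+1 -> R) :
  (forall i, 0 < w i) -> \sum_i w i = 1 ->
  (forall i k, 0 <= f i k) -> (forall z, 0 <= H z) ->
  (forall (z : n.-tuple 'I_M.+1) (k : I -> n.-tuple 'I_M.+1),
    (forall j, `|(tnth z j : nat)%:R - \sum_i w i * (tnth (k i) j : nat)%:R| < 1) ->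
    \prod_i f i (k i) `^ w i <= H z) ->
  \prod_i (\sum_k f i k) `^ w i <= \sum_z H z.
Proof.
move=> w0 w1; elim: n f H => [|n IH] f H f0 H0 fH.
  have sum0 (F : 0.-tuple 'I_M.+1 -> R) : \sum_k F k = F [tuple].
    rewrite (bigD1 [tuple])//= big1 ?addr0// => k; by case/eqP; exact: tuple0.
  rewrite sum0; under eq_bigr do rewrite sum0.
  by apply: (fH [tuple] (fun=> [tuple])) => -[].
rewrite big_tuple_cons; under eq_bigr do rewrite big_tuple_cons.
apply: prekopa_leindler_1d => // [i k|z|z k zk]; [exact: sumr_ge0|exact: sumr_ge0|].
apply: IH => // z' k' zk'; apply: (fH _ (fun i => [tuple of k i :: k' i])) => j.
case: (unliftP ord0 j) => [j' ->|->].
  by rewrite tnthS; under eq_bigr do rewrite tnthS.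
by rewrite tnth0; under eq_bigr do rewrite tnth0.
Qed.

(** * The discrete Brunn-Minkowski inequality *)

Section Lattice.
Variables (R : realType) (n : nat).
Implicit Types (A B K : set 'rV[R]_n).

Definition box_point (m : nat) (k : n.-tuple 'I_(m.*2).+1) : 'rV[R]_n :=
  \row_j ((tnth k j : nat)%:R - m%:R).

Lemma bounded_in_box A : bounded_set A ->
  exists m : nat, forall x i, A x -> `|x 0 i| <= m%:R.
Proof.
move=> [M0 [_ /(_ (M0 + 1))]]; rewrite ltrDl ltr01 => /(_ isT) AM.
exists (Num.bound (M0 + 1)) => x i /AM /= xM.
apply/ltW/(@le_lt_trans _ _ (M0 + 1)); last first.
  by apply: archi_boundP; exact: le_trans xM.
apply: le_trans xM; rewrite [in leRHS]/Num.norm /= mx_normrE.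
exact: (le_bigmax _ (fun ij => `|x ij.1 ij.2|) (0, i)).
Qed.

Lemma lattice_count_box A (m : nat) : (forall x i, A x -> `|x 0 i| <= m%:R) ->
  lattice_count A = #|[set k | `[< A (@box_point m k) >]]%SET|.
Proof.
move=> Am; rewrite /lattice_count.
have finj : injective (@box_point m).
  move=> k l /rowP kl; apply: eq_from_tnth => j; apply/val_inj/eqP.
  by have := kl j; rewrite !mxE => /addIr/eqP; rewrite eqr_nat.
rewrite -[RHS]card_finset.
set S := [fset k in _]%fset.
transitivity (#|` [fset @box_point m k | k in S]|%fset); last by rewrite card_imfset.
congr (#|` _|); apply/fsetP => x.
have finA : finite_set (A `&` integer_lattice).
  apply: finite_lattice_points; exists m%:R; split; first exact: num_real.
  move=> M mM y Ay; rewrite /= [leLHS]/Num.norm/= mx_normrE.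
  apply: bigmax_le => [|[i j] _]; first by rewrite (le_trans _ (ltW mM)).
  by rewrite /= ord1 (le_trans (Am _ _ Ay))// ltW.
rewrite in_fset_set//; apply/idP/imfsetP => /=.
  rewrite inE => -[Ax xZ].
  have /choice[k kx] j : exists k : 'I_(m.*2).+1, x 0 j = (k : nat)%:R - m%:R.
    have := Am _ j Ax; have /intrP[z xz] := xZ j.
    rewrite xz -[m%:R]/((Posz m)%:~R) -intr_norm ler_int => zm.
    have zm' : (absz (z + m%:Z)%R < m.*2.+1)%N by lia.
    exists (Ordinal zm') => /=.
    have /(congr1 (fun y : int => y%:~R : R)) :
      (absz (z + m%:Z))%:Z = z + m%:Z by lia.
    by rewrite intrD -!pmulrn => ->; rewrite addrK.
  have xE : x = box_point [tuple of [seq k j | j <- ord_tuple n]].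
    by apply/rowP => j; rewrite mxE tnth_map tnth_ord_tuple kx.
  by exists [tuple of [seq k j | j <- ord_tuple n]] => //; rewrite !inE -xE.
move=> [k]; rewrite !inE => Ak ->; split=> // j; rewrite mxE.
by rewrite rpredB// ?rpred_nat.
Qed.

(** The Prekopa-Leindler inequality for the indicator functions of the sets, in a
    box that contains all of them. *)
Lemma discrete_brunn_minkowski
    (I : finType) (w : I -> R) (A : I -> set 'rV[R]_n) B :
  (forall i, 0 < w i) -> \sum_i w i = 1 ->
  (forall i, bounded_set (A i)) -> bounded_set B ->
  (forall a c, (forall i, A i (a i)) -> open_cube c -> B (\sum_i w i *: a i + c)) ->
  \prod_i (lattice_count (A i))%:R `^ w i <= (lattice_count B)%:R.
Proof.
move=> w0 w1 bA /bounded_in_box[mB mBP] AB.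
have /choice[mA mAP] := fun i => bounded_in_box (bA i).
pose m := maxn mB (\max_i mA i).
have Am i x j : A i x -> `|x 0 j| <= m%:R.
  move=> /mAP -/(_ j) /le_trans; apply; rewrite ler_nat.
  by rewrite leq_max leq_bigmax orbT.
have Bm x j : B x -> `|x 0 j| <= m%:R.
  move=> /mBP -/(_ j) /le_trans; apply; rewrite ler_nat.
  by rewrite leq_max leqnn.
rewrite (lattice_count_box Bm).
rewrite (natr_card_set _ (fun k => `[< B (box_point k) >])).
rewrite (eq_bigr (fun i =>
    (\sum_k (`[< A i (@box_point m k) >] : bool)%:R) `^ w i)); last first.
  move=> i _; rewrite (lattice_count_box (Am i)).
  by rewrite (natr_card_set _ (fun k => `[< A i (box_point k) >])).
apply: prekopa_leindler_tuple => // z k zk.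
have [[i Ai]|/forallNP allA] := pselect (exists i, ~ A i (box_point (k i))).
  rewrite (@prod_powR_eq0 _ _ _ _ i)//; last by move/asboolPn: Ai => /negbTE ->.
have {}allA i : A i (box_point (k i)) by apply: contrapT; exact: allA.
suff -> : `[< B (box_point z) >].
  by rewrite big1// => i _; rewrite asboolT// powR1.
apply/asboolP.
have -> : box_point z = \sum_i w i *: box_point (k i) +
    (box_point z - \sum_i w i *: box_point (k i)) by rewrite addrC subrK.
apply: AB => // j; rewrite !mxE summxE.
rewrite (eq_bigr (fun i => w i * (tnth (k i) j : nat)%:R - w i * m%:R)); last first.
  by move=> i _; rewrite !mxE mulrBr.
rewrite sumrB -mulr_suml w1 mul1r.
have := zk j; set S := \sum_i _; rewrite ltr_norml => zS; lra.
Qed.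

Lemma convex_set_segment K x y (t : R) : convex_set K -> 0 <= t <= 1 -> K x -> K y ->
  K (t *: x + (1 - t) *: y).
Proof.
move=> cK /andP[t0 t1] Kx Ky.
by have := cK x y (Itv01 t0 t1) (mem_set Kx) (mem_set Ky) => /set_mem.
Qed.

Lemma convex_set_sum K (I : finType) (w : I -> R) (y : I -> 'rV[R]_n) :
  convex_set K -> (forall i, 0 < w i) -> \sum_i w i = 1 -> (forall i, K (y i)) ->
  K (\sum_i w i *: y i).
Proof.
move=> cK w0 w1 Ky.
(* Partial sums are normalized to stay convex combinations. *)
suff H : forall s : seq I, 0 < \sum_(i <- s) w i ->
    K ((\sum_(i <- s) w i)^-1 *: \sum_(i <- s) w i *: y i).
  by have := H (index_enum I); rewrite w1 invr1 scale1r; apply.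
elim=> [|i s IH]; first by rewrite big_nil ltxx.
have [->|[j js]] : s = [::] \/ exists j, j \in s.
- by case: (s) => [|j s']; [left|right; exists j; rewrite mem_head].
- by rewrite !big_seq1 scalerA mulVf ?scale1r ?gt_eqF.
rewrite !big_cons; set W := \sum_(j <- s) w j in IH *.
set S := \sum_(j <- s) _ in IH *.
have W0 : 0 < W.
  rewrite /W (perm_big _ (perm_to_rem js))/= big_cons ltr_pwDl// sumr_ge0// => k _.
  exact: ltW.
move=> wW0.
have -> : (w i + W)^-1 *: (w i *: y i + S) =
    (w i / (w i + W)) *: y i + (1 - w i / (w i + W)) *: (W^-1 *: S).
  rewrite scalerDr !scalerA; congr (_ *: _ + _ *: _); first by rewrite mulrC.
  by field; rewrite !gt_eqF.
apply: convex_set_segment => //; last exact: IH.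
apply/andP; split; first by apply: divr_ge0; exact: ltW.
by rewrite ler_pdivrMr// mul1r lerDl ltW.
Qed.

End Lattice.

(** * Covariograms of convex sets *)

Section Covariogram.
Variables (R : realType) (n : nat).
Implicit Types (A B K L : set 'rV[R]_n).

Lemma bounded_subset A B : A `<=` B -> bounded_set B -> bounded_set A.
Proof.
by move=> AB [M [Mr BM]]; exists M; split => // x /BM Bx y /AB /Bx.
Qed.

Lemma bounded_minkowski_open_cube K :
  bounded_set K -> bounded_set (minkowski_sum K open_cube).
Proof.
move=> [M0 [_ /(_ (M0 + 1))]]; rewrite ltrDl ltr01 => /(_ isT) KM.
exists (M0 + 2); split; first exact: num_real.
move=> x Mx y [a /KM/= aM] [c cC <-] /=.
apply: (le_trans (ler_normD _ _)).
have : `|c| <= 1.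
  rewrite [leLHS]/Num.norm/= mx_normrE; apply: bigmax_le => // -[i j] _ /=.
  by rewrite ord1 ler_norml; case/andP: (cC j) => ? ?; rewrite !ltW.
lra.
Qed.

Lemma convex_minkowski_open_cube K :
  convex_set K -> convex_set (minkowski_sum K open_cube).
Proof.
move=> cK x y t; rewrite !inE => -[a Ka [c cC <-]] [b Kb [d dC <-]].
have t0 : 0 <= t%:num by []. have t1 : t%:num <= 1 by [].
exists (t%:num *: a + (1 - t%:num) *: b).
  by apply: convex_set_segment => //; rewrite t0.
exists (t%:num *: c + (1 - t%:num) *: d).
  move=> j; rewrite !mxE; have /andP[c1 c2] := cC j; have /andP[d1 d2] := dC j.
  have u0 : 0 <= 1 - t%:num by rewrite subr_ge0.
  move: t0; rewrite le_eqVlt => /predU1P[<-|t0].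
    by rewrite !mul0r subr0 !mul1r !add0r d1.
  have lo : 0 < t%:num * (c 0 j + 1) by apply: mulr_gt0 => //; lra.
  have hi : 0 < t%:num * (1 - c 0 j) by apply: mulr_gt0 => //; lra.
  have lo' : 0 <= (1 - t%:num) * (d 0 j + 1) by apply: mulr_ge0 => //; lra.
  have hi' : 0 <= (1 - t%:num) * (1 - d 0 j) by apply: mulr_ge0 => //; lra.
  by apply/andP; split; lra.
by rewrite /conv/= !scalerDr addrACA.
Qed.

Lemma lattice_count_le A B : A `<=` B -> bounded_set B ->
  (lattice_count A <= lattice_count B)%N.
Proof.
move=> AB bB; apply/fsubset_leq_card; rewrite -fset_set_sub.
- by apply: setSI.
- exact/finite_lattice_points/bounded_subset/bB.
- exact: finite_lattice_points.
Qed.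

Lemma lattice_count_gt0 A : A 0 -> bounded_set A -> (0 < lattice_count A)%N.
Proof.
move=> A0 bA; rewrite /lattice_count cardfs_gt0; apply/fset0Pn; exists 0.
rewrite in_fset_set; last exact: finite_lattice_points.
by rewrite inE; split=> // i; rewrite mxE; exact: rpred0.
Qed.

Lemma translateE x A y : translate x A y <-> A (y - x).
Proof.
split=> [[a Aa <-]|Ayx]; first by rewrite addrAC subrr add0r.
by exists (y - x) => //; rewrite addrC subrK.
Qed.

Lemma covariogram0 L : discrete_covariogram L 0 = (lattice_count L)%:R.
Proof.
congr (lattice_count _)%:R; apply/seteqP; split => [x []//|x Lx].
by split=> //; apply/translateE; rewrite subr0.
Qed.

Lemma covariogram_ge0 L x : 0 <= discrete_covariogram L x.
Proof. by rewrite /discrete_covariogram ler0n. Qed.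

(** If [y] and [y - x] are in [L], so is [y - t x], which lies between them. *)
Lemma covariogram_ray L x (t : R) : convex_set L -> bounded_set L ->
  0 <= t <= 1 -> discrete_covariogram L x <= discrete_covariogram L (t *: x).
Proof.
move=> cL bL t01; rewrite ler_nat; apply: lattice_count_le; last first.
  by apply: bounded_subset bL => y [].
move=> y [Ly /translateE Lyx]; split => //; apply/translateE.
have -> : y - t *: x = t *: (y - x) + (1 - t) *: y.
  by rewrite scalerBr scalerBl scale1r addrCA addrAC subrr add0r.
exact: convex_set_segment.
Qed.

Lemma covariogram_vanish L x : bounded_set L -> x != 0 ->
  exists r0, forall r, r0 < r -> discrete_covariogram L (r *: x) = 0.
Proof.
move=> [M0 [_ /(_ (M0 + 1))]]; rewrite ltrDl ltr01 => /(_ isT) LM x0.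
have nx0 : 0 < `|x| by rewrite normr_gt0.
exists (Num.max 0 (2 * (M0 + 1) / `|x|)) => r; rewrite gt_max => /andP[r0 rx].
rewrite /discrete_covariogram (_ : _ `&` _ = set0); last first.
  apply/seteqP; split => // y [/LM/= yM /translateE/LM/= yxM].
  move: rx; rewrite ltr_pdivrMr//.
  have : `|r *: x| = r * `|x| by rewrite normrZ gtr0_norm.
  have : `|r *: x| <= `|y| + `|y - r *: x|.
    by rewrite -[X in `|X| <= _](subKr y) -[leRHS]/(_ + _); apply: ler_normB.
  lra.
by rewrite /lattice_count set0I fset_set0 cardfs0.
Qed.

Lemma covariogram_concave K (I : finType) (w : I -> R) (y : I -> 'rV[R]_n) :
  convex_set K -> bounded_set K -> (forall i, 0 < w i) -> \sum_i w i = 1 ->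
  \prod_i discrete_covariogram K (y i) `^ w i <=
    discrete_covariogram (minkowski_sum K open_cube) (\sum_i w i *: y i).
Proof.
move=> cK bK w0 w1; apply: discrete_brunn_minkowski => //.
- by move=> i; apply: bounded_subset bK => x [].
- by apply: bounded_subset (bounded_minkowski_open_cube bK) => x [].
move=> a c Ka cC; split.
  exists (\sum_i w i *: a i); last by exists c.
  by apply: convex_set_sum => // i; case: (Ka i).
apply/translateE; exists (\sum_i w i *: (a i - y i)).
  by apply: convex_set_sum => // i; apply/translateE; case: (Ka i).
exists c => //.
rewrite (eq_bigr (fun i => w i *: a i - w i *: y i)); last first.
  by move=> i _; rewrite scalerBr.
by rewrite sumrB addrAC.
Qed.

End Covariogram.

(** * Scaling of integrals and the measure dr / r^2 *)

(** Lebesgue measure is [c] times its image under multiplication by [c], because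
    the two agree on half-open intervals. *)
Lemma ge0_integral_scale (R : realType) (c : R) (g : R -> R) : 0 < c ->
  measurable_fun (`]0%R, +oo[%classic : set R) g -> (forall r, 0 < r -> 0 <= g r) ->
  (\int[lebesgue_measure]_(r in `]0%R, +oo[) (g r)%:E =
   c%:E * \int[lebesgue_measure]_(r in `]0%R, +oo[) (g (c * r))%:E)%E.
Proof.
move=> c0 mg g0.
pose phi : measurableTypeR R -> measurableTypeR R := fun r => c * r.
have mphi : measurable_fun setT phi by exact: measurable_funM.
pose c' : {nonneg R} := NngNum (ltW c0).
have [push pushE] : exists m : {measure set (measurableTypeR R) -> \bar R},
    forall A, m A = pushforward lebesgue_measure phi A.
  by unshelve refine (ex_intro _
    (pushforward lebesgue_measure phi : {measure set _ -> \bar R}) _).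
pose nu := mscale c' push.
have nuE A : measurable A -> lebesgue_measure A = nu A.
  apply: lebesgue_measure_unique => X [[a b] _ <-] /=.
  rewrite /nu /mscale/= pushE /pushforward [LHS]lebesgue_measure_itv/=.
  rewrite (_ : phi @^-1` _ = `]c^-1 * a, c^-1 * b]%classic); last first.
    apply/seteqP; split => r /=; rewrite /phi !in_itv/=.
      by rewrite ltr_pdivrMl// ler_pdivlMl.
    by rewrite ltr_pdivrMl// ler_pdivlMl.
  rewrite lebesgue_measure_itv/= !lte_fin ltr_pM2l ?invr_gt0//.
  case: ifPn => // _; rewrite ?mule0// -!EFinB -EFinM; congr EFin.
  by field; rewrite gt_eqF.
have mD : measurable (`]0%R, +oo[%classic : set R) by [].
transitivity (\int[nu]_(r in `]0%R, +oo[) (g r)%:E)%E.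
  by apply: eq_measure_integral => A mA _; exact: nuE.
rewrite ge0_integral_mscale//; last 2 first.
- exact/measurable_EFinP.
- by move=> r /=; rewrite in_itv/= andbT lee_fin; exact: g0.
congr (_ * _)%E.
transitivity (\int[pushforward lebesgue_measure phi]_(r in `]0%R, +oo[) (g r)%:E)%E.
  by apply: eq_measure_integral => A mA _; exact: pushE.
rewrite ge0_integral_pushforward//.
- rewrite (_ : phi @^-1` _ = `]0%R, +oo[%classic)//.
  by apply/seteqP; split => r /=; rewrite /phi !in_itv/= !andbT pmulr_rgt0.
- exact/measurable_EFinP.
- by move=> r; rewrite inE/= in_itv/= andbT lee_fin; exact: g0.
Qed.

Section InverseSquareMass.
Variable R : realType.
Implicit Types (a b r : R) (J : set R).

(** The image of Lebesgue measure under [r |-> 1 / r]: the weighted harmonic mean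
    of two intervals has the weighted sum of their masses. *)
Definition inv_sq_mass J : \bar R :=
  (\int[lebesgue_measure]_(r in J) (r `^ (-2))%:E)%E.

Lemma measurable_inv_sq (D : set R) : measurable D ->
  measurable_fun D (fun r : R => (r `^ (-2))%:E).
Proof.
by move=> mD; apply/measurable_EFinP; apply: (measurable_funS measurableT).
Qed.

Lemma inv_sq_mass_cc a b : 0 < a -> a <= b ->
  inv_sq_mass `[a, b] = (a^-1 - b^-1)%:E.
Proof.
move=> a0; rewrite le_eqVlt => /predU1P[<-|ab].
  by rewrite /inv_sq_mass set_itv1 integral_set1 subrr.
have inv_der r : 0 < r -> is_derive r 1 (fun x : R => - x^-1) (r ^- 2).
  move=> r0; rewrite -[r ^- 2]opprK; apply: is_deriveN.
  have := @is_deriveV R id r 1 1; rewrite /= => /(_ _ (is_derive_id _ _)).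
  by rewrite gt_eqF// => /(_ isT); rewrite scaler1; apply.
have cinv r : 0 < r -> {for r, continuous (fun x : R => x^-1)}.
  by move=> r0; apply: inv_continuous; rewrite gt_eqF.
have itv0 r : r \in `[a, b] -> 0 < r.
  by rewrite in_itv/= => /andP[ar _]; exact: lt_le_trans ar.
rewrite /inv_sq_mass.
transitivity (\int[lebesgue_measure]_(r in `[a, b]) (r ^- 2)%:E)%E.
  apply: eq_integral => r; rewrite inE/= => /itv0 r0; congr EFin.
  by rewrite (powR_invn 2)// ltW.
rewrite (@continuous_FTC2 _ (fun r => r ^- 2) (fun r => - r^-1))//.
- by rewrite -EFinB opprK addrC.
- apply: continuous_in_subspaceT => r; rewrite inE/= => /itv0 r0.
  rewrite (_ : (fun x : R => x ^- 2) = (fun x => x^-1 ^+ 2)); last first.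
    by apply/funext => x; rewrite exprVn.
  by apply: (@continuousM _ _ (fun x : R => x^-1) (fun x : R => x^-1)); exact: cinv.
- split.
  + move=> r; rewrite in_itv/= => /andP[ar _].
    by have [] := inv_der r (lt_trans a0 ar).
  + by apply: cvg_at_right_filter; apply: cvgN; exact: cinv.
  + by apply: cvg_at_left_filter; apply: cvgN; apply: cinv; exact: lt_trans ab.
- move=> r; rewrite in_itv/= => /andP[ar _]; rewrite derive1E.
  by have /@derive_val -> := inv_der r (lt_trans a0 ar).
Qed.

Lemma inv_sq_mass_oo a b : 0 < a -> a <= b ->
  inv_sq_mass `]a, b[ = (a^-1 - b^-1)%:E.
Proof.
move=> a0 ab; rewrite -inv_sq_mass_cc// /inv_sq_mass; apply/esym.
by rewrite (integral_itv_bndoo true false)//; exact: measurable_inv_sq.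
Qed.

Lemma inv_sq_mass_le J a b : measurable J -> 0 < a -> a <= b ->
  J `<=` `[a, b] -> (inv_sq_mass J <= (a^-1 - b^-1)%:E)%E.
Proof.
move=> mJ a0 ab Jab; rewrite -inv_sq_mass_cc//.
apply: ge0_subset_integral => //; first exact: measurable_inv_sq.
by move=> r _; rewrite lee_fin powR_ge0.
Qed.

Lemma inv_sq_mass_ge J a b : measurable J -> 0 < a -> a <= b ->
  `]a, b[ `<=` J -> ((a^-1 - b^-1)%:E <= inv_sq_mass J)%E.
Proof.
move=> mJ a0 ab Jab; rewrite -inv_sq_mass_oo//.
apply: ge0_subset_integral => //; first exact: measurable_inv_sq.
by move=> r _; rewrite lee_fin powR_ge0.
Qed.

Lemma inv_sq_mass_ge0 J : (0 <= inv_sq_mass J)%E.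
Proof. by apply: integral_ge0 => r _; rewrite lee_fin powR_ge0. Qed.

Lemma interval_between_inf_sup J r : is_interval J -> has_inf J -> has_sup J ->
  inf J < r -> r < sup J -> J r.
Proof.
move=> iJ hi hs ir rs.
have [s Js sr] := inf_lt hi.1 ir; have [t Jt rt] := sup_gt hs.1 rs.
by apply: (iJ s t Js Jt); rewrite !ltW.
Qed.

(** In the variable [1 / r] this is the inequality [|u A + v B| <= |C|] for
    intervals [A] and [B] and a set [C] containing [u A + v B]. The lower bound
    [e] keeps the masses finite. *)
Lemma inv_sq_mass_harmonic (u v : R) (J1 J2 J : set R) (e M : R) :
  0 < u -> 0 < v -> u + v = 1 -> 0 < e ->
  is_interval J1 -> is_interval J2 -> measurable J ->
  J1 !=set0 -> J2 !=set0 ->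
  (forall r, J1 r -> e <= r <= M) -> (forall r, J2 r -> e <= r <= M) ->
  (forall r s, J1 r -> J2 s -> J (u / r + v / s)^-1) ->
  (u%:E * inv_sq_mass J1 + v%:E * inv_sq_mass J2 <= inv_sq_mass J)%E.
Proof.
move=> u0 v0 uv e0 i1 i2 mJ n1 n2 J1b J2b J12.
have bnd J' : J' !=set0 -> (forall r, J' r -> e <= r <= M) ->
    [/\ has_inf J', has_sup J', e <= inf J', inf J' <= sup J'
      & J' `<=` `[inf J', sup J']].
  move=> [r Jr] b.
  have hi : has_inf J' by split; [exists r|exists e => s /b /andP[]].
  have hs : has_sup J' by split; [exists r|exists M => s /b /andP[]].
  have le s : J' s -> inf J' <= s <= sup J'.
    by move=> Js; rewrite ge_inf ?ub_le_sup//; [exact: hs.2|exact: hi.2].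
  split=> //.
  - by apply: lb_le_inf; [exists r|move=> s /b /andP[]].
  - by case/andP: (le _ Jr) => /le_trans; apply.
have [hi1 hs1 e1 is1 sub1] := bnd _ n1 J1b.
have [hi2 hs2 e2 is2 sub2] := bnd _ n2 J2b.
set a1 := inf J1 in hi1 hs1 e1 is1 sub1.
set b1 := sup J1 in hi1 hs1 e1 is1 sub1.
set a2 := inf J2 in hi2 hs2 e2 is2 sub2.
set b2 := sup J2 in hi2 hs2 e2 is2 sub2.
have a10 : 0 < a1 by exact: lt_le_trans e1.
have a20 : 0 < a2 by exact: lt_le_trans e2.
have b10 : 0 < b1 by exact: lt_le_trans is1.
have b20 : 0 < b2 by exact: lt_le_trans is2.
have hpos r s : 0 < r -> 0 < s -> 0 < u / r + v / s.
  by move=> r0 s0; rewrite addr_gt0// divr_gt0.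
have ba1 : b1^-1 <= a1^-1 by rewrite lef_pV2.
have ba2 : b2^-1 <= a2^-1 by rewrite lef_pV2.
pose t1 := (u / a1 + v / a2)^-1; pose t2 := (u / b1 + v / b2)^-1.
have t12 : t1 <= t2.
  by rewrite lef_pV2 ?posrE ?hpos// lerD// ler_wpM2l// ltW.
have t10 : 0 < t1 by rewrite invr_gt0 hpos.
apply: (@le_trans _ _ (t1^-1 - t2^-1)%:E).
  apply: (@le_trans _ _
    (u%:E * (a1^-1 - b1^-1)%:E + v%:E * (a2^-1 - b2^-1)%:E)%E).
    apply: leeD; (apply: lee_wpmul2l; first by rewrite lee_fin ltW).
      by apply: inv_sq_mass_le => //; exact: is_interval_measurable.
    by apply: inv_sq_mass_le => //; exact: is_interval_measurable.
  rewrite -!EFinM -EFinD lee_fin !invrK; lra.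
(* A point strictly between [t1] and [t2] is a harmonic mean of points at the
   same relative position [th] in [J1] and [J2], in the coordinate [1 / r]. *)
apply: inv_sq_mass_ge => // t /=; rewrite in_itv/= => /andP[t1t tt2].
have t0 : 0 < t := lt_trans t10 t1t.
have t20 : 0 < t2 := lt_trans t0 tt2.
have lo : t2^-1 < t^-1 by rewrite ltf_pV2.
have hi : t^-1 < t1^-1 by rewrite ltf_pV2.
have d0 : 0 < t1^-1 - t2^-1 by rewrite subr_gt0 (lt_trans lo).
pose th := (t^-1 - t2^-1) / (t1^-1 - t2^-1).
have th0 : 0 < th by rewrite divr_gt0// subr_gt0.
have th1 : th < 1 by rewrite ltr_pdivrMr// mul1r ltrD2r.
have tE : t^-1 = th * t1^-1 + (1 - th) * t2^-1.
  by rewrite mulrBl mul1r addrCA -mulrBr /th divfK ?gt_eqF// addrC subrK.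
have mid J' a b : is_interval J' -> has_inf J' -> has_sup J' -> J' !=set0 ->
    a = inf J' -> b = sup J' -> J' `<=` `[a, b] -> 0 < a -> a <= b ->
    J' (th * a^-1 + (1 - th) * b^-1)^-1.
  move=> iJ hi' hs' [r Jr] aE bE sub a0.
  have b0 : a <= b -> 0 < b by apply: lt_le_trans.
  rewrite le_eqVlt => /predU1P[ab|ab].
    have := sub _ Jr; rewrite -ab /= in_itv/= => ra.
    rewrite -mulrDl addrCA subrr addr0 mul1r invrK.
    by suff -> : a = r by []; apply/eqP; rewrite eq_le.
  have {}b0 := b0 (ltW ab).
  have ab' : b^-1 < a^-1 by rewrite ltf_pV2.
  have th1' : 0 < 1 - th by rewrite subr_gt0.
  have S0 : 0 < th * a^-1 + (1 - th) * b^-1.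
    by rewrite addr_gt0// mulr_gt0// invr_gt0.
  have thd : 0 < th * (a^-1 - b^-1) by rewrite mulr_gt0// subr_gt0.
  have th1d : 0 < (1 - th) * (a^-1 - b^-1) by rewrite mulr_gt0// subr_gt0.
  apply: interval_between_inf_sup => //; rewrite -?aE -?bE.
    by rewrite -[ltLHS]invrK ltf_pV2 ?posrE ?invr_gt0//; lra.
  by rewrite -[ltRHS]invrK ltf_pV2 ?posrE ?invr_gt0//; lra.
have := J12 _ _ (mid _ a1 b1 i1 hi1 hs1 n1 erefl erefl sub1 a10 is1)
                (mid _ a2 b2 i2 hi2 hs2 n2 erefl erefl sub2 a20 is2).
rewrite !invrK; suff -> : u * (th * a1^-1 + (1 - th) * b1^-1) +
   v * (th * a2^-1 + (1 - th) * b2^-1) = t^-1 by rewrite invrK.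
by rewrite tE /t1 /t2 !invrK; ring.
Qed.

End InverseSquareMass.

(** * Integration over the levels *)

Definition superlevel (R : realType) (phi : R -> R) (b : R) : set R :=
  [set r | 0 < r /\ b < phi r].

Section LayerCake.
Variable R : realType.
Local Notation mu := (@lebesgue_measure R).
Local Notation D := (`]0%R, +oo[%classic : set R).

(** Tonelli's theorem for [r ^ (-2)] on the region [{(r, b) | 0 < b < phi r}]. *)
Lemma layer_cake_inv_sq (phi : R -> R) :
  measurable_fun D phi -> (forall r, 0 < r -> 0 <= phi r) ->
  measurable_fun D (fun b => inv_sq_mass (superlevel phi b)) /\
  (\int[mu]_(r in D) (r `^ (-2) * phi r)%:E =
   \int[mu]_(b in D) inv_sq_mass (superlevel phi b))%E.
Proof.
move=> mphi phi0; have mD : measurable D by [].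
have ND r : r <= 0 -> r \in ~` D.
  by move=> r0; rewrite inE/= in_itv/= andbT; apply/negP; rewrite -leNgt.
have [psi [mpsi psiE psiN]] : exists psi : R -> R, [/\ measurable_fun setT psi,
    forall r, 0 < r -> psi r = phi r & forall r, r <= 0 -> psi r = 0].
  exists (phi \_ D); split; first exact/(measurable_restrictT phi mD).
    by move=> r r0; rewrite patchT// inE/= in_itv/= r0.
  by move=> r r0; rewrite patchC// ND.
have psi0 r : 0 <= psi r.
  by have [/psiN->//|r0] := leP r 0; rewrite psiE// phi0.
pose S := [set z : R * R | 0 < z.2 /\ z.2 < psi z.1].
pose f (z : measurableTypeR R * measurableTypeR R) : \bar R :=
  (z.1 `^ (-2) * \1_S z)%:E.
have LE : (\int[mu]_x \int[mu]_y f (x, y) =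
    \int[mu]_(r in D) (r `^ (-2) * phi r)%:E)%E.
  rewrite [RHS]integral_mkcond; apply: eq_integral => x _.
  have -> : (\int[mu]_y f (x, y) = (x `^ (-2) * psi x)%:E)%E.
    rewrite (_ : (fun y => f (x, y)) = (fun y =>
        (x `^ (-2))%:E * (\1_(`]0, psi x[%classic : set R) y)%:E)%E); last first.
      apply/funext => y; rewrite /f EFinM; congr (_ * _%:E)%E.
      rewrite !indicE; congr (nat_of_bool _)%:R.
      by apply/idP/idP; rewrite !inE /S/= in_itv/= => /andP.
    rewrite ge0_integralZl//; last first.
    - by rewrite lee_fin powR_ge0.
    - exact/measurable_EFinP/measurable_indic.
    rewrite integral_indic//= setIT lebesgue_measure_itv/= lte_fin EFinM.
    congr (_ * _)%E.
    have := psi0 x; rewrite le_eqVlt => /predU1P[<-|->]; last by rewrite sube0.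
    by rewrite ltxx.
  have [x0|x0] := ltP 0 x; first by rewrite patchT ?inE/= ?in_itv/= ?x0// psiE.
  by rewrite patchC ?ND// psiN ?mulr0.
have GE y : (\int[mu]_x f (x, y) =
    ((fun b => inv_sq_mass (superlevel phi b)) \_ D) y)%E.
  have [y0|y0] := ltP 0 y; last first.
    rewrite patchC ?ND//.
    rewrite integral0_eq// => x _; rewrite /f indicE memNset ?mulr0// => -[/=].
    by rewrite ltNge y0.
  rewrite patchT ?inE/= ?in_itv/= ?y0// /inv_sq_mass [RHS]integral_mkcond.
  apply: eq_integral => x _; rewrite /f indicE.
  have [xJ|xJ] := pselect (superlevel phi y x).
    rewrite patchT ?inE// mem_set ?mulr1//; split=> //=.
    by case: xJ => x0; rewrite psiE.
  rewrite patchC ?inE// memNset ?mulr0// => -[_ /= yx]; apply: xJ.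
  have [x0|x0] := leP x 0; last by split; rewrite -?psiE.
  by move: yx; rewrite psiN// ltNge ltW.
have mS : measurable (S : set (measurableTypeR R * measurableTypeR R)).
  rewrite (_ : S = [set z : R * R | 0 < z.2] `&` [set z : R * R | z.2 < psi z.1])//.
  apply: measurableI.
    have := @measurable_fun_ltr _ (measurableTypeR R * measurableTypeR R)%type R setT
      (cst 0) (fun z => z.2) (measurable_cst _) measurable_snd.
    by move=> /(_ measurableT [set true] I); rewrite setTI.
  have := @measurable_fun_ltr _ (measurableTypeR R * measurableTypeR R)%type R setT
      (fun z => z.2) (fun z => psi z.1) measurable_snd
      (measurableT_comp mpsi measurable_fst).
  by move=> /(_ measurableT [set true] I); rewrite setTI.
have mf : measurable_fun setT f.
  apply/measurable_EFinP; apply: measurable_funM; last exact: measurable_indic.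
  apply: (@measurableT_comp _ _ _ _ _ _ (@powR R ^~ (-2))) => //.
have f0 z : (0 <= f z)%E by rewrite lee_fin mulr_ge0// powR_ge0.
have ftE := @fubini_tonelli _ _ _ _ _ mu mu f mf f0.
split; last first.
  rewrite -LE ftE [RHS]integral_mkcond; apply: eq_integral => y _; exact: GE.
apply/(measurable_restrictT _ mD).
rewrite (_ : _ \_ _ = (fun y => \int[mu]_x f (x, y))%E); last first.
  by apply/funext => y; rewrite -GE.
exact: (@measurable_fun_fubini_tonelli_G _ _ _ _ _ mu f mf f0).
Qed.

Lemma le_integral_of_superlevels (u v : R) (phi1 phi2 phi : R -> R) :
  0 <= u -> 0 <= v ->
  measurable_fun D phi1 -> measurable_fun D phi2 -> measurable_fun D phi ->
  (forall r, 0 < r -> 0 <= phi1 r <= 1) ->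
  (forall r, 0 < r -> 0 <= phi2 r <= 1) ->
  (forall r, 0 < r -> 0 <= phi r) ->
  (forall b : R, 0 < b < 1 ->
    (u%:E * inv_sq_mass (superlevel phi1 b)
       + v%:E * inv_sq_mass (superlevel phi2 b)
      <= inv_sq_mass (superlevel phi b))%E) ->
  (u%:E * \int[mu]_(r in D) (r `^ (-2) * phi1 r)%:E +
   v%:E * \int[mu]_(r in D) (r `^ (-2) * phi2 r)%:E <=
   \int[mu]_(r in D) (r `^ (-2) * phi r)%:E)%E.
Proof.
move=> u0 v0 m1 m2 m p1 p2 p0 lev.
have mD : measurable D by [].
have [mN1 ->] := layer_cake_inv_sq m1 (fun r r0 => (andP (p1 r r0)).1).
have [mN2 ->] := layer_cake_inv_sq m2 (fun r r0 => (andP (p2 r r0)).1).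
have [mN ->] := layer_cake_inv_sq m p0.
have N0 psi b : (0 <= inv_sq_mass (superlevel psi b))%E := inv_sq_mass_ge0 _.
rewrite -ge0_integralZl//.
rewrite -ge0_integralZl//.
rewrite -ge0_integralD//; last 4 first.
- by move=> b _; rewrite mule_ge0 ?lee_fin.
- exact: measurable_funeM.
- by move=> b _; rewrite mule_ge0 ?lee_fin.
- exact: measurable_funeM.
apply: ge0_le_integral => //.
- by move=> b _; rewrite adde_ge0 ?mule_ge0 ?lee_fin.
- by apply: emeasurable_funD; exact: measurable_funeM.
move=> b /=; rewrite in_itv/= andbT => b0.
have [b1|b1] := ltP b 1; first by apply: lev; rewrite b0.
have empty psi :
    (forall r, 0 < r -> 0 <= psi r <= 1) -> superlevel psi b = set0.
  move=> psi1; apply/seteqP; split=> // r [/psi1/andP[_ pr1]].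
  by rewrite ltNge (le_trans pr1).
rewrite (empty phi1 p1) (empty phi2 p2) /inv_sq_mass !integral_set0 !mule0.
by rewrite adde0 integral_ge0// => r _; rewrite lee_fin powR_ge0.
Qed.

End LayerCake.

(** * Ball's theorem for log-concave functions *)

Section Ball.
Variables (R : realType) (V : lmodType R) (p : R).
Hypothesis p0 : 0 < p.
Implicit Types (F : V -> R) (x y : V).
Local Notation D := (`]0%R, +oo[%classic : set R).

Definition moment F x : \bar R :=
  (\int[lebesgue_measure]_(r in D) (r `^ (p - 1) * F (r *: x))%:E)%E.

Definition ray_nonincreasing F :=
  forall x (t : R), 0 <= t <= 1 -> F x <= F (t *: x).

Lemma measurable_ray F x : ray_nonincreasing F ->
  measurable_fun D (fun r => F (r *: x)).
Proof.
move=> Fray; have : measurable_fun D (fun r : R => F (Num.max r 0 *: x)).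
  apply: nonincreasing_measurable => // s t st.
  have [t0|t0] := leP t 0; first by rewrite !max_r// (le_trans st).
  have -> : Num.max s 0 *: x = (Num.max s 0 / t) *: (t *: x).
    by rewrite scalerA divfK ?gt_eqF.
  apply: Fray.
  apply/andP; split.
    by apply: divr_ge0; [rewrite le_max lexx orbT|exact: ltW].
  by rewrite ler_pdivrMr// mul1r ge_max st ltW.
apply: eq_measurable_fun => r; rewrite inE/= in_itv/= andbT => r0.
by rewrite max_l// ltW.
Qed.

Lemma measurable_moment F x : ray_nonincreasing F ->
  measurable_fun D (fun r => r `^ (p - 1) * F (r *: x)).
Proof.
move=> Fray; apply: measurable_funM; last exact: measurable_ray.
exact: (measurable_funS measurableT).
Qed.

Lemma moment_le F G x : ray_nonincreasing F -> ray_nonincreasing G ->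
  (forall y, 0 <= F y) -> (forall y, F y <= G y) -> (moment F x <= moment G x)%E.
Proof.
move=> Fray Gray F0 FG; apply: ge0_le_integral => //.
- by move=> r _; rewrite lee_fin mulr_ge0// powR_ge0.
- by apply/measurable_EFinP; exact: measurable_moment.
- by apply/measurable_EFinP; exact: measurable_moment.
- by move=> r _; rewrite lee_fin ler_wpM2l// powR_ge0.
Qed.

Lemma moment_ray F x (t : R) : ray_nonincreasing F -> (forall y, 0 <= F y) ->
  0 <= t <= 1 -> (moment F x <= moment F (t *: x))%E.
Proof.
move=> Fray F0 t01; apply: ge0_le_integral => //.
- by move=> r _; rewrite lee_fin mulr_ge0// powR_ge0.
- by apply/measurable_EFinP; exact: measurable_moment.
- by apply/measurable_EFinP; exact: measurable_moment.
- move=> r _; rewrite lee_fin ler_wpM2l ?powR_ge0//.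
  have -> : r *: (t *: x) = t *: (r *: x) by rewrite !scalerA mulrC.
  exact: Fray.
Qed.

Lemma moment_scale F x (c : R) : ray_nonincreasing F -> (forall y, 0 <= F y) ->
  0 < c -> (moment F x = (c `^ p)%:E * moment F (c *: x))%E.
Proof.
move=> Fray F0 c0.
rewrite {1}/moment (ge0_integral_scale c0) //; last 2 first.
- exact: measurable_moment.
- by move=> r _; rewrite mulr_ge0// powR_ge0.
rewrite -(mulr_powRB1 (ltW c0) p0) EFinM -muleA; congr (_ * _)%E.
rewrite /moment -ge0_integralZl//; last 3 first.
- by apply/measurable_EFinP; exact: measurable_moment.
- by move=> r _; rewrite lee_fin mulr_ge0// powR_ge0.
- by rewrite lee_fin powR_ge0.
apply: eq_integral => r; rewrite inE/= in_itv/= andbT => r0.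
rewrite -EFinM powRM ?(ltW c0) ?(ltW r0)// -mulrA; congr (_ * (_ * F _))%:E.
by rewrite scalerA mulrC.
Qed.

(** The power [p + 1] is the one for which the superlevel sets of the weighted
    restrictions to rays combine along harmonic means, see
    [superlevel_harmonic]. *)
Definition weighted_ray F x (r : R) : R := r `^ (p + 1) * F (r *: x).

Lemma moment_weighted_ray F x :
  (moment F x =
   \int[lebesgue_measure]_(r in D) (r `^ (-2) * weighted_ray F x r)%:E)%E.
Proof.
apply: eq_integral => r; rewrite inE/= in_itv/= andbT => r0.
rewrite /weighted_ray mulrA -powRD; last by rewrite (gt_eqF r0) implybT.
by congr (_ `^ _ * _)%:E; ring.
Qed.

Definition log_concave F := forall x y (u v : R), 0 < u -> 0 < v -> u + v = 1 ->
  F x `^ u * F y `^ v <= F (u *: x + v *: y).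

Lemma AGM2 (a b u v : R) : 0 <= a -> 0 <= b -> 0 < u -> 0 < v -> u + v = 1 ->
  a `^ u * b `^ v <= u * a + v * b.
Proof.
move=> a0 b0 u0 v0 uv.
have := @weighted_AGM R bool (fun i => if i then u else v)
  (fun i => if i then a else b).
by rewrite !big_bool/=; apply=> // -[] //; exact: ltW.
Qed.

Variable F : V -> R.
Hypothesis F0 : forall x, 0 <= F x.
Hypothesis Fray : ray_nonincreasing F.
Hypothesis Flc : log_concave F.
Hypothesis Fvan :
  forall x, x != 0 -> exists r0, forall r, r0 < r -> F (r *: x) = 0.

Local Notation phi := (weighted_ray F).
Local Notation J x b := (superlevel (phi x) b).

Lemma weighted_ray_ge0 x r : 0 <= phi x r.
Proof. by rewrite mulr_ge0// powR_ge0. Qed.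

Lemma measurable_weighted_ray x : measurable_fun D (phi x).
Proof.
apply: measurable_funM; last exact: measurable_ray.
exact: (measurable_funS measurableT).
Qed.

(** The point [t (u x + v y)] is the mean of [r x] and [s y] with the weights
    [m = t u / r] and [l = t v / s], so log-concavity bounds [F] there from below
    by [F (r x) ^ m * F (s y) ^ l]. Since [t = m r + l s], the inequality of
    means gives [t >= r ^ m * s ^ l], which takes care of the power of [t]. *)
Lemma superlevel_harmonic x y (u v b r s : R) : 0 < u -> 0 < v -> u + v = 1 ->
  0 < b -> J x b r -> J y b s -> J (u *: x + v *: y) b (u / r + v / s)^-1.
Proof.
move=> u0 v0 uv b0 [r0 br] [s0 bs]; set t := _^-1.
have T0 : 0 < u / r + v / s by rewrite addr_gt0// divr_gt0.
have t0 : 0 < t by rewrite invr_gt0.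
have tV : t * (u / r + v / s) = 1 by rewrite mulVf ?gt_eqF.
pose m := t * u / r; pose l := t * v / s.
have m0 : 0 < m by rewrite divr_gt0// mulr_gt0.
have l0 : 0 < l by rewrite divr_gt0// mulr_gt0.
have ml : m + l = 1 by rewrite -tV mulrDr /m /l !mulrA.
have mr : m * r = t * u by rewrite /m divfK ?gt_eqF.
have ls : l * s = t * v by rewrite /l divfK ?gt_eqF.
split=> //; apply: (@lt_le_trans _ _ (phi x r `^ m * phi y s `^ l)).
  have bE : b = b `^ m * b `^ l.
    by rewrite -powRD ?ml ?powRr1 ?(ltW b0)// (gt_eqF b0) implybT.
  rewrite [ltLHS]bE; apply: ltr_pM; rewrite ?powR_ge0//.
    by apply: gt0_ltr_powR; rewrite ?nnegrE ?(ltW b0) ?weighted_ray_ge0.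
  by apply: gt0_ltr_powR; rewrite ?nnegrE ?(ltW b0) ?weighted_ray_ge0.
rewrite /weighted_ray !powRM ?powR_ge0// mulrACA; apply: ler_pM.
- by rewrite mulr_ge0 ?powR_ge0.
- by rewrite mulr_ge0 ?powR_ge0.
- rewrite [r `^ _ `^ _]powRAC [s `^ _ `^ _]powRAC -powRM ?powR_ge0//.
  apply: ge0_ler_powR; rewrite ?nnegrE ?mulr_ge0 ?powR_ge0//; try exact: ltW.
    by rewrite addr_ge0// ltW.
  apply: le_trans (AGM2 (ltW r0) (ltW s0) m0 l0 ml) _.
  by rewrite mr ls -mulrDr uv mulr1.
- have -> : t *: (u *: x + v *: y) = m *: (r *: x) + l *: (s *: y).
    by rewrite scalerDr !scalerA mr ls.
  exact: Flc.
Qed.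

(** Every point between [r] and [s] is a weighted harmonic mean of them. *)
Lemma superlevel_interval x b : 0 < b -> is_interval (J x b).
Proof.
move=> b0 r s Jr Js t /andP[]; rewrite le_eqVlt => /predU1P[<-//|rt].
rewrite le_eqVlt => /predU1P[->//|ts].
have r0 : 0 < r := Jr.1. have t0 := lt_trans r0 rt. have s0 := lt_trans t0 ts.
have rtV : t^-1 < r^-1 by rewrite ltf_pV2.
have tsV : s^-1 < t^-1 by rewrite ltf_pV2.
have d0 : 0 < r^-1 - s^-1 by rewrite subr_gt0 (lt_trans tsV).
pose u := (t^-1 - s^-1) / (r^-1 - s^-1).
pose v := (r^-1 - t^-1) / (r^-1 - s^-1).
have u0 : 0 < u by rewrite divr_gt0// subr_gt0.
have v0 : 0 < v by rewrite divr_gt0// subr_gt0.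
have uv : u + v = 1.
  by rewrite -mulrDl addrC subrKA divff// gt_eqF.
have := superlevel_harmonic u0 v0 uv b0 Jr Js; rewrite -scalerDl uv scale1r.
suff -> : u / r + v / s = t^-1 by rewrite invrK.
rewrite /u /v; move: d0; move: (r^-1) (s^-1) (t^-1) => A B T d0.
by field; rewrite gt_eqF.
Qed.

Lemma le_at_origin x : F x <= F 0.
Proof. by rewrite -(scale0r x); apply: Fray; rewrite lexx ler01. Qed.

Lemma superlevel_bounded x y (b : R) : x != 0 -> y != 0 -> 0 < b -> J x b !=set0 ->
  exists e M, [/\ 0 < e, forall r, J x b r -> e <= r <= M
                 & forall r, J y b r -> e <= r <= M].
Proof.
move=> /Fvan[Mx xM] /Fvan[My yM] b0 [r1 [r10 br1]].
have F00 : 0 < F 0.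
  rewrite lt_neqAle F0 andbT eq_sym; apply/eqP => F00.
  have Fx0 : F (r1 *: x) = 0.
    by apply/eqP; rewrite eq_le F0 andbT -F00 le_at_origin.
  by move: br1; rewrite /weighted_ray Fx0 mulr0 ltNge (ltW b0).
have pp : 0 < p + 1 by rewrite addr_gt0.
have lo z r : 0 < r -> b < phi z r -> (b / F 0) `^ (p + 1)^-1 <= r.
  move=> r0 br; rewrite leNgt; apply/negP => re.
  have : r `^ (p + 1) <= b / F 0.
    have -> : b / F 0 = ((b / F 0) `^ (p + 1)^-1) `^ (p + 1).
      by rewrite -powRrM mulVf ?gt_eqF// powRr1// ltW// divr_gt0.
    by apply: ge0_ler_powR; rewrite ?nnegrE ?powR_ge0 ?ltW.
  rewrite ler_pdivlMr// leNgt => /negP; apply; apply: lt_le_trans br _.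
  by rewrite /weighted_ray ler_wpM2l ?powR_ge0 ?le_at_origin.
exists ((b / F 0) `^ (p + 1)^-1), (Num.max Mx My); split.
- by rewrite powR_gt0// divr_gt0.
- move=> r [r0 br]; apply/andP; split.
    exact: lo br.
  rewrite le_max; apply/orP; left; rewrite leNgt; apply/negP => /xM Fx0.
  by move: br; rewrite /weighted_ray Fx0 mulr0 ltNge (ltW b0).
- move=> r [r0 br]; rewrite (lo _ _ _ br)//=.
  rewrite le_max; apply/orP; right; rewrite leNgt; apply/negP => /yM Fy0.
  by move: br; rewrite /weighted_ray Fy0 mulr0 ltNge (ltW b0).
Qed.

(** Replacing [x] by [c x] divides the supremum of [phi x] by [c ^ (p + 1)]. The
    supremum is finite because [F] is bounded and vanishes far out on the ray,
    and positive because the moment is. *)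
Lemma exists_normalization x (M : R) : x != 0 -> 0 < M -> (M%:E <= moment F x)%E ->
  exists2 c, 0 < c & (forall r, 0 < r -> phi (c *: x) r <= 1) /\
    (forall b, b < 1 -> exists2 r, 0 < r & b < phi (c *: x) r).
Proof.
move=> x0 M0 Mx; have [r0 Fr0] := Fvan x0.
have pp : 0 < p + 1 by rewrite addr_gt0.
pose E := [set phi x r | r in D].
have hsE : has_sup E.
  split; first by exists (phi x 1); exists 1 => //=; rewrite in_itv/= ltr01.
  exists (Num.max r0 0 `^ (p + 1) * F 0) => _ [r /= + <-].
  rewrite in_itv/= andbT => rp.
  have [rr0|/Fr0 Fr] := leP r r0; last first.
    by rewrite /weighted_ray Fr mulr0 mulr_ge0// powR_ge0.
  apply: ler_pM; rewrite ?powR_ge0 ?le_at_origin//.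
  apply: ge0_ler_powR; rewrite ?nnegrE ?(ltW pp) ?(ltW rp)//.
    by rewrite le_max lexx orbT.
  by rewrite le_max rr0.
have Esup r : 0 < r -> phi x r <= sup E.
  move=> rp; apply: ub_le_sup; first exact: hsE.2.
  by exists r => //=; rewrite in_itv/= rp.
set a := sup E in Esup.
have a0 : 0 < a.
  rewrite ltNge; apply/negP => a_le0.
  suff : moment F x = 0%E by move=> m0; move: Mx; rewrite m0 lee_fin leNgt M0.
  rewrite moment_weighted_ray; apply: integral0_eq => r /=.
  rewrite in_itv/= andbT => rp.
  have -> : phi x r = 0.
    by apply/eqP; rewrite eq_le weighted_ray_ge0 (le_trans (Esup _ rp)).
  by rewrite mulr0.
exists (a `^ (p + 1)^-1); first by rewrite powR_gt0.
set c := a `^ _; have c0 : 0 < c by rewrite powR_gt0.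
have cE : c `^ (p + 1) = a by rewrite -powRrM mulVf ?gt_eqF// powRr1// ltW.
have phiE r : 0 < r -> phi (c *: x) r = phi x (c * r) / a.
  move=> rp; rewrite /weighted_ray powRM ?ltW// cE scalerA [r * c]mulrC.
  by field; rewrite gt_eqF.
split=> [r rp|b b1].
  by rewrite phiE// ler_pdivrMr// mul1r Esup// mulr_gt0.
have : b * a < sup E by rewrite gtr_pMl.
move=> /(sup_gt hsE.1)[_ [r /= + <-]]; rewrite in_itv/= andbT => rp bar.
exists (r / c); first by rewrite divr_gt0.
by rewrite phiE ?divr_gt0// [c * _]mulrC divfK ?gt_eqF// ltr_pdivlMr.
Qed.

(** When [phi x] and [phi y] both have supremum 1, their superlevel sets are
    nonempty for exactly the same levels, and the bound is strong: concavity of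
    the moment, not of a power of it. *)
Lemma moment_normalized x y (u v : R) :
  x != 0 -> y != 0 -> 0 < u -> 0 < v -> u + v = 1 ->
  (forall r, 0 < r -> phi x r <= 1) ->
  (forall b, b < 1 -> exists2 r, 0 < r & b < phi x r) ->
  (forall r, 0 < r -> phi y r <= 1) ->
  (forall b, b < 1 -> exists2 r, 0 < r & b < phi y r) ->
  (u%:E * moment F x + v%:E * moment F y <= moment F (u *: x + v *: y))%E.
Proof.
move=> x0 y0 u0 v0 uv x1 xs y1 ys; rewrite !moment_weighted_ray.
apply: le_integral_of_superlevels; rewrite ?ltW//; do ?exact: measurable_weighted_ray.
- by move=> r r0; rewrite weighted_ray_ge0 x1.
- by move=> r r0; rewrite weighted_ray_ge0 y1.
- by move=> r r0; rewrite weighted_ray_ge0.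
move=> b /andP[b0 b1].
have Jx : J x b !=set0 by have [r r0 br] := xs _ b1; exists r.
have Jy : J y b !=set0 by have [r r0 br] := ys _ b1; exists r.
have [e [M [e0 xb yb]]] := superlevel_bounded x0 y0 b0 Jx.
apply: (inv_sq_mass_harmonic u0 v0 uv e0 _ _ _ Jx Jy xb yb).
- exact: superlevel_interval.
- exact: superlevel_interval.
- by apply: is_interval_measurable; exact: superlevel_interval.
- by move=> r s; exact: superlevel_harmonic.
Qed.

Lemma convex_powR_weighted (q u v a b : R) :
  1 <= q -> 0 < u -> 0 < v -> u + v = 1 ->
  0 <= a -> 0 <= b -> (u * a + v * b) `^ q <= u * a `^ q + v * b `^ q.
Proof.
move=> q1 u0 v0 uv a0 b0.
have u01 : 0 <= u <= 1 by lra.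
have := @convex_powR R q q1 (Itv01 (andP u01).1 (andP u01).2) a b.
rewrite !inE/= !in_itv/= !andbT => /(_ a0 b0).
have -> : v = 1 - u by lra.
exact.
Qed.

(** Normalize to [x' = c x] and [y' = d y]. The point [z = u x + v y] is [T]
    times a mean of [x'] and [y'] with weights [u / (c T)] and [v / (d T)], where
    [T = u / c + v / d]. Homogeneity and [moment_normalized] bound the moment at
    [z] below by [M] times the quotient of [u / c ^ (p + 1) + v / d ^ (p + 1)]
    by [T ^ (p + 1)], and convexity of the power makes this quotient at least
    1. *)
Theorem moment_quasi_concave x y (u v M : R) :
  0 < M -> 0 < u -> 0 < v -> u + v = 1 ->
  (M%:E <= moment F x)%E -> (M%:E <= moment F y)%E ->
  (M%:E <= moment F (u *: x + v *: y))%E.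
Proof.
move=> M0 u0 v0 uv Mx My.
have [->|x0] := eqVneq x 0.
  rewrite scaler0 add0r (le_trans My)//; apply: moment_ray => //; lra.
have [->|y0] := eqVneq y 0.
  rewrite scaler0 addr0 (le_trans Mx)//; apply: moment_ray => //; lra.
have [c c0 [c1 cs]] := exists_normalization x0 M0 Mx.
have [d d0 [d1 ds]] := exists_normalization y0 M0 My.
pose k := c^-1; pose e := d^-1.
have k0 : 0 < k by rewrite invr_gt0. have e0 : 0 < e by rewrite invr_gt0.
pose T := u * k + v * e.
have T0 : 0 < T by rewrite addr_gt0// mulr_gt0.
pose u' := u * k / T; pose v' := v * e / T.
have u'0 : 0 < u' by rewrite divr_gt0// mulr_gt0.
have v'0 : 0 < v' by rewrite divr_gt0// mulr_gt0.
have uv' : u' + v' = 1 by rewrite -mulrDl divff// gt_eqF.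
pose x' := c *: x; pose y' := d *: y.
have x'0 : x' != 0 by rewrite scaler_eq0 negb_or gt_eqF.
have y'0 : y' != 0 by rewrite scaler_eq0 negb_or gt_eqF.
have zE : T^-1 *: (u *: x + v *: y) = u' *: x' + v' *: y'.
  rewrite scalerDr !scalerA; congr (_ *: _ + _ *: _).
    by rewrite /u' /k; field; rewrite !gt_eqF.
  by rewrite /v' /e; field; rewrite !gt_eqF.
have lb w (cc : R) : 0 < cc -> (M%:E <= moment F w)%E ->
    (((cc^-1) `^ p * M)%:E <= moment F (cc *: w))%E.
  move=> cc0 Mw; have ccV : cc^-1 `^ p * cc `^ p = 1.
    by rewrite -powRM ?invr_ge0 ?ltW// mulVf ?gt_eqF// powR1.
  rewrite EFinM -[leRHS]mul1e -ccV [X in (_ <= X * _)%E]EFinM -muleA.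
  by apply: lee_wpmul2l; rewrite ?lee_fin ?powR_ge0// -moment_scale.
have := moment_normalized x'0 y'0 u'0 v'0 uv' c1 cs d1 ds.
rewrite -zE => H.
have TV : 0 < T^-1 by rewrite invr_gt0.
rewrite (moment_scale _ Fray F0 TV).
apply: (@le_trans _ _ (((T^-1) `^ p)%:E *
    (u'%:E * (k `^ p * M)%:E + v'%:E * (e `^ p * M)%:E))%E); last first.
  apply: lee_wpmul2l; first by rewrite lee_fin powR_ge0.
  apply: le_trans H; apply: leeD; (apply: lee_wpmul2l; first by rewrite lee_fin ltW).
    exact: lb.
  exact: lb.
rewrite -[leRHS]/((T^-1 `^ p *
  (u' * (k `^ p * M) + v' * (e `^ p * M)))%:E) lee_fin.
have p1 : 1 <= p + 1 by rewrite lerDr ltW.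
have := convex_powR_weighted p1 u0 v0 uv (ltW k0) (ltW e0); rewrite -/T.
have powS a : 0 < a -> a `^ (p + 1) = a * a `^ p.
  by move=> a0; rewrite powRD ?(gt_eqF a0) ?implybT// powRr1 ?ltW// mulrC.
rewrite !powS// => jensen.
have TVE : T^-1 `^ p = (T `^ p)^-1.
  by rewrite -powR_inv1 ?(ltW T0)// -powRrM mulN1r powRN.
have Tp0 : 0 < T `^ p by rewrite powR_gt0.
rewrite TVE ler_pdivlMl// -(ler_pM2l T0).
have -> : T * (u' * (k `^ p * M) + v' * (e `^ p * M)) =
    (u * (k * k `^ p) + v * (e * e `^ p)) * M.
  by rewrite /u' /v'; field; rewrite gt_eqF.
by rewrite mulrA ler_wpM2r// ltW.
Qed.

End Ball.

(** * The log-concave envelope *)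

Section Envelope.
Variables (R : realType) (V : lmodType R) (f h : V -> R).
Implicit Types (x y : V).

Definition geometric_means x : set R :=
  [set t | exists (I : finType) (w : I -> R) (y : I -> V),
    [/\ forall i, 0 < w i, \sum_i w i = 1, \sum_i w i *: y i = x
      & t = \prod_i f (y i) `^ w i]].

Definition log_concave_envelope x : R := sup (geometric_means x).

Local Notation F := log_concave_envelope.

Hypothesis f0 : forall x, 0 <= f x.
Hypothesis fh : forall (I : finType) (w : I -> R) (y : I -> V),
  (forall i, 0 < w i) -> \sum_i w i = 1 ->
  \prod_i f (y i) `^ w i <= h (\sum_i w i *: y i).

Lemma geometric_means_self x : geometric_means x (f x).
Proof.
exists unit, (fun=> 1), (fun=> x); rewrite !big_const !card_unit/=.
by rewrite !addr0 scale1r mulr1 powRr1.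
Qed.

Lemma geometric_means_le x t : geometric_means x t -> t <= h x.
Proof. by move=> [I [w [y [w0 w1 <- ->]]]]; exact: fh. Qed.

Lemma has_sup_geometric_means x : has_sup (geometric_means x).
Proof.
split; first by exists (f x); exact: geometric_means_self.
by exists (h x) => t; exact: geometric_means_le.
Qed.

Lemma geometric_means_le_envelope x t : geometric_means x t -> t <= F x.
Proof. by move=> xt; apply: ub_le_sup => //; case: (has_sup_geometric_means x). Qed.

Lemma le_envelope x : f x <= F x.
Proof. exact/geometric_means_le_envelope/geometric_means_self. Qed.

Lemma envelope_le x : F x <= h x.
Proof.
apply: ge_sup; first by case: (has_sup_geometric_means x).
by move=> t; exact: geometric_means_le.
Qed.

Lemma envelope_ge0 x : 0 <= F x.
Proof. exact: le_trans (le_envelope x). Qed.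

(** Contracting all the points of a combination contracts the combination. *)
Lemma envelope_ray : ray_nonincreasing f -> ray_nonincreasing F.
Proof.
move=> fray x t t01; apply: ge_sup; first by case: (has_sup_geometric_means x).
move=> _ [I [w [y [w0 w1 <- ->]]]].
apply: (@le_trans _ _ (\prod_i f (t *: y i) `^ w i)).
  apply: ler_prod => i _; rewrite powR_ge0/=.
  by apply: ge0_ler_powR; rewrite ?nnegrE ?f0 ?(ltW (w0 i))// fray.
apply: geometric_means_le_envelope; exists I, w, (fun i => t *: y i); split=> //.
by rewrite scaler_sumr; apply: eq_bigr => i _; rewrite !scalerA mulrC.
Qed.

Lemma sup_powR_mul (A : set R) (u k C : R) :
  A !=set0 -> 0 < u -> 0 <= k -> 0 <= C ->
  (forall a, A a -> 0 <= a) ->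
  (forall a, A a -> a `^ u * k <= C) -> (sup A) `^ u * k <= C.
Proof.
move=> A0 u0; rewrite le_eqVlt => /predU1P[<- C0|k0 C0] Apos AC.
  by rewrite mulr0.
have Ck0 : 0 <= C / k by rewrite divr_ge0// ltW.
have le a : A a -> a <= (C / k) `^ u^-1.
  move=> Aa; rewrite -[leLHS](powRr1 (Apos _ Aa)) -(divff (lt0r_neq0 u0)) powRrM.
  apply: ge0_ler_powR; rewrite ?nnegrE ?powR_ge0 ?invr_ge0 ?(ltW u0)//.
  by rewrite ler_pdivlMr// AC.
have sA0 : 0 <= sup A.
  have [a Aa] := A0; apply: le_trans (Apos _ Aa) _; apply: ub_le_sup => //.
  by exists ((C / k) `^ u^-1).
rewrite -ler_pdivlMr//.
have -> : C / k = ((C / k) `^ u^-1) `^ u by rewrite -powRrM mulVf ?gt_eqF// powRr1.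
apply: ge0_ler_powR; rewrite ?nnegrE ?powR_ge0 ?(ltW u0)//.
by apply: ge_sup.
Qed.

(** A convex combination of convex combinations is one, indexed by the disjoint
    union. *)
Lemma envelope_log_concave : log_concave F.
Proof.
move=> x y u v u0 v0 uv.
have pos z t : geometric_means z t -> 0 <= t.
  by move=> [I [w [a [_ _ _ ->]]]]; apply: prodr_ge0 => i _; rewrite powR_ge0.
apply: sup_powR_mul => //; rewrite ?powR_ge0 ?envelope_ge0//.
- by case: (has_sup_geometric_means x).
- exact: pos.
move=> s xs; rewrite mulrC; apply: sup_powR_mul; rewrite ?powR_ge0 ?envelope_ge0//.
- by case: (has_sup_geometric_means y).
- exact: pos.
move=> t yt; rewrite mulrC; apply: geometric_means_le_envelope.
case: xs => [I [w [a [w0 w1 <- ->]]]].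
case: yt => [I' [w' [a' [w'0 w'1 <- ->]]]].
exists (I + I')%type.
exists (fun i => match i with inl i => u * w i | inr j => v * w' j end).
exists (fun i => match i with inl i => a i | inr j => a' j end); split.
- by case=> i; rewrite mulr_gt0.
- by rewrite big_sumType/= -!mulr_sumr w1 w'1 !mulr1.
- rewrite big_sumType/= !scaler_sumr; congr (_ + _).
    by apply: eq_bigr => i _; rewrite scalerA.
  by apply: eq_bigr => i _; rewrite scalerA.
- rewrite big_sumType/= !powR_prod => [| i|i]; [|exact: powR_ge0|exact: powR_ge0].
  congr (_ * _).
    by apply: eq_bigr => i _; rewrite -powRrM mulrC.
  by apply: eq_bigr => i _; rewrite -powRrM mulrC.
Qed.

End Envelope.

(** * The inclusion of Ball bodies *)

Unset Implicit Arguments.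

Theorem proposition6p3 (R : realType) (n : nat) (K : set 'rV[R]_n) (p : R)
    (hK : convex_body K) (hK0 : K 0) (hp : 0 < p) :
  convex_hull (ball_body p (discrete_covariogram K)) `<=`
  dilate
    (((lattice_count (minkowski_sum K open_cube))%:R
      / (lattice_count K)%:R) `^ p^-1)
    (ball_body p (discrete_covariogram (minkowski_sum K open_cube))).
Proof.
have [/compact_bounded bK cK _] := hK.
set L := minkowski_sum K open_cube.
have bL : bounded_set L := bounded_minkowski_open_cube bK.
have cL : convex_set L := convex_minkowski_open_cube cK.
have L0 : L 0.
  exists 0 => //; exists 0; last by rewrite addr0.
  by move=> i; rewrite mxE oppr_lt0 ltr01.
set f := discrete_covariogram K; set h := discrete_covariogram L.
have fh (I : finType) (w : I -> R) (y : I -> 'rV[R]_n) : (forall i, 0 < w i) ->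
    \sum_i w i = 1 -> \prod_i f (y i) `^ w i <= h (\sum_i w i *: y i).
  exact: covariogram_concave.
have f0 x : 0 <= f x := covariogram_ge0 K x.
have fray : ray_nonincreasing f by move=> x t; exact: covariogram_ray.
have hray : ray_nonincreasing h by move=> x t; exact: covariogram_ray.
pose F := log_concave_envelope f.
have F0 x : 0 <= F x := envelope_ge0 f0 fh x.
have Fray : ray_nonincreasing F := envelope_ray f0 fh fray.
have Flc : log_concave F := envelope_log_concave f0 fh.
have Fvan x : x != 0 -> exists r0, forall r, r0 < r -> F (r *: x) = 0.
  move=> /(covariogram_vanish bL)[r0 hr0]; exists r0 => r /hr0 hr.
  by apply/eqP; rewrite eq_le F0 andbT -hr; exact: envelope_le.
rewrite -(covariogram0 L) -(covariogram0 K) -/f -/h.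
have f00 : 0 < f 0 by rewrite /f covariogram0 ltr0n lattice_count_gt0.
have h00 : 0 < h 0 by rewrite /h covariogram0 ltr0n lattice_count_gt0.
have ballE (g : 'rV[R]_n -> R) (M : R) x :
    (M%:E <= p%:E * moment p g x)%E = ((M / p)%:E <= moment p g x)%E.
  by rewrite mulrC EFinM lee_pdivrMl.
pose S : set 'rV[R]_n := [set x | ((f 0)%:E <= p%:E * moment p F x)%E].
have cS : convex_set S.
  apply/convex_setW => x y; rewrite !inE /S/= !ballE => Sx Sy k k0 k1.
  rewrite inE /= ballE.
  apply: (moment_quasi_concave hp F0 Fray Flc Fvan) => //.
  - exact: divr_gt0.
  - by rewrite subr_gt0.
  - by rewrite addrC subrK.
apply: (@subset_trans _ S).
  apply: smallest_sub => // x; rewrite /ball_body/= => fx; apply: le_trans fx _.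
  apply: lee_wpmul2l; first by rewrite lee_fin ltW.
  by apply: moment_le => //; exact: (le_envelope f0 fh).
move=> z; rewrite /S/= => Sz.
set c := (h 0 / f 0) `^ p^-1.
have c0 : 0 < c by rewrite powR_gt0// divr_gt0.
have cp : c `^ p = h 0 / f 0.
  by rewrite -powRrM mulVf ?gt_eqF// powRr1// ltW// divr_gt0.
exists (c^-1 *: z); last by rewrite scalerA mulfV ?gt_eqF// scale1r.
rewrite /ball_body/= -/(moment p h _).
have Sz' : ((f 0)%:E <= p%:E * moment p h z)%E.
  apply: le_trans Sz _; apply: lee_wpmul2l; first by rewrite lee_fin ltW.
  by apply: moment_le => //; exact: (envelope_le f0 fh).
have h_ge0 x : 0 <= h x := covariogram_ge0 L x.
have := moment_scale hp (c^-1 *: z) hray h_ge0 c0.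
have -> : c *: (c^-1 *: z) = z by rewrite scalerA mulfV ?gt_eqF// scale1r.
rewrite cp => ->.
rewrite muleCA -[leLHS]mul1e.
have -> : (h 0)%:E = ((h 0 / f 0)%:E * (f 0)%:E)%E by rewrite -EFinM divfK ?gt_eqF.
by rewrite mul1e lee_wpmul2l// lee_fin ltW// divr_gt0.
Qed.
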